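(* Let $K\ge 1$ be an integer and let $\lambda,\theta,\mu>0$. Consider the single-server queue with Poisson arrivals of rate $\lambda$, Erlang-$K$ service times with rate $\mu$ in each phase (phases observable), and exponential patience times of rate $\theta$, modelled as the continuous-time Markov decision process described in the context. Then the SREPT policy (in each state $s=(x_1,\dots,x_K)\neq 0$ serve a customer with $a_s=\min\{i:x_i>0\}$ remaining phases; idle in state $0$) maximizes the long-run average throughput: for every initial state $s\in S$, $$g(s,\mathrm{SREPT})=\sup_{\pi\in\Pi} g(s,\pi).$$
   Context: Model. Customers arrive according to a Poisson process with rate $\lambda$ to a single-server queue with infinite buffer. Each customer's service time is Erlang-$K$, i.e. the sum of $K$ independent exponential phases of rate $\mu$. Each customer in the system (including the one in service) abandons after an exponentially distributed time with rate $\theta$. The server may idle or serve any customer present; preemption is allowed, policies are non-anticipating, and the number of remaining phases of each customer is observable. State space: $S=\mathbb{N}^K$ with $\mathbb{N}=\{0,1,2,\dots\}$; in state $s=(x_1,\dots,x_K)$, $x_i$ is the number of customers with $i$ remaining phases. Actions: $A(s)=\{i:x_i>0\}\cup\{0\}$; action $i\geq 1$ means serving a customer with $i$ remaining phases and action $0$ means idling. Write $e_i$ for the $i$-th unit vector. Transition rates from $s$ under $a\in A(s)$: to $s+e_K$ at rate $\lambda$; to $s-e_1$ at rate $\mu\mathbf 1_{a=1}+x_1\theta$ (if $x_1>0$); for $k>1$ with $x_k\ge 1$, to $s+e_{k-1}-e_k$ at rate $\mu\mathbf 1_{a=k}$, and to $s-e_k$ at rate $x_k\theta$; no other transitions out of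 $s$. Reward rate: $r(s,a)=\mu\mathbf 1_{a=1}$ (so the expected accumulated reward equals the expected number of service completions). Policies: $\Pi$ is the set of admissible (non-anticipating, preemptive, possibly randomized and time-dependent) scheduling policies; a policy $\pi$ at time $t$ in state $s$ chooses its action in $A(s)$ according to a probability distribution $\rho_t(\cdot\mid s)$ on $A(s)$. Put $R(t,s,\pi)=\sum_{a\in A(s)} r(s,a)\rho_t(a\mid s)$, let $X^\pi(t)$ be the resulting continuous-time Markov chain on $S$, and define the long-run average throughput $$g(s,\pi)=\liminf_{T\to\infty}\frac1T\,\mathbb{E}^\pi_s\Big[\int_0^T R(t,X^\pi(t),\pi)\,dt\Big].$$ *)

(* Defs.v *)
From HB Require Import structures.
From mathcomp Require Import all_boot all_order all_algebra.
From mathcomp Require Import all_classical all_reals all_analysis.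

Set Implicit Arguments.
Unset Strict Implicit.
Unset Printing Implicit Defensive.

Import Order.TTheory GRing.Theory Num.Theory.
Import numFieldNormedType.Exports.

Local Open Scope classical_set_scope.
Local Open Scope ring_scope.

Section MarkovChain.
Context {R : realType} {S : choiceType}.

(* [p u x t y] is the probability of being in [y] at time [t] given [x] at time
   [u], for [0 <= u <= t].  The last clause is the Kolmogorov backward equation
     - d/du p u x t y = \sum_z q u x z * (p u z t y - p u x t y)
   integrated over [u, t], because [q] is only assumed measurable in time.
   [q u x] must have finite support; its value on the diagonal plays no role. *)
Definition is_transition_function
    (q : R -> S -> S -> R) (p : R -> S -> R -> S -> R) : Prop :=
  [/\ (forall (u : R) x t y, 0 <= u -> u <= t -> 0 <= p u x t y),
      (forall (u : R) x t, 0 <= u -> u <= t ->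
         (\esum_(y in [set: S]) (p u x t y)%:E = 1)%E),
      (forall (u : R) x v t y, 0 <= u -> u <= v -> v <= t ->
         ((p u x t y)%:E
          = \esum_(z in [set: S]) (p u x v z * p v z t y)%:E)%E),
      (forall x (t : R) y,
         measurable_fun `[0 : R, t]%classic (fun u : R => p u x t y)) &
      (forall (u : R) x t y, 0 <= u -> u <= t ->
         p u x t y = (x == y)%:R +
           \int[lebesgue_measure]_(w in `[u, t])
             \sum_(z \in [set: S]) q w x z * (p w z t y - p w x t y))].

(* A jointly measurable process [X t], [0 <= t], which is a (possibly
   time-inhomogeneous) Markov chain with transition rates [q], started at [s].
   The Markov property is written as a product formula, so as not to condition
   on null events. *)
Definition is_markov_chain (q : R -> S -> S -> R) (s : S)
    (d : measure_display) (Omega : measurableType d) (P : probability Omega R)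
    (X : R -> Omega -> S) : Prop :=
  [/\ (forall y, measurable
         [set tw : measurableTypeR R * Omega | 0 <= tw.1 /\ X tw.1 tw.2 = y]),
      P [set w | X 0 w = s] = 1%E &
      exists2 p, is_transition_function q p &
        forall (n : nat) (t : nat -> R) (y : nat -> S),
          0 <= t 0%N -> (forall i, t i <= t i.+1) ->
          P (\bigcap_(i < n.+2) [set w | X (t i) w = y i])
          = (P (\bigcap_(i < n.+1) [set w | X (t i) w = y i])
             * (p (t n) (y n) (t n.+1) (y n.+1))%:E)%E].

End MarkovChain.

(* The coordinate [s i], for [i : 'I_K], is the number of customers with [i.+1]
   remaining phases. *)
Definition state (K : nat) := {ffun 'I_K -> nat}.

(* Action [0] is idling; action [k >= 1] serves a customer with [k] remaining
   phases. *)
Definition action (K : nat) := 'I_K.+1.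

Definition feasible (K : nat) (s : state K) : {set action K} :=
  [set a | (a == ord0) || [exists i : 'I_K, (a == i.+1 :> nat) && (0 < s i)%N]].

(* The unit vector attached to [k] remaining phases; [unit_state K 0] is the
   zero vector, a customer with no remaining phase being out of the system. *)
Definition unit_state (K k : nat) : state K :=
  [ffun i : 'I_K => (i.+1 == k) : nat].

Definition add_state (K : nat) (s e : state K) : state K :=
  [ffun i => (s i + e i)%N].

Definition sub_state (K : nat) (s e : state K) : state K :=
  [ffun i => (s i - e i)%N].

Section Model.
Context {R : realType} (K : nat) (lambda theta mu : R).

(* The three kinds of transition are an arrival, the completion of a phase
   (which for [i = 0] is a departure to [s - e_1]) and an abandonment. *)
Definition rate (a : action K) (s s' : state K) : R :=
  lambda * (s' == add_state s (unit_state K K))%:R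
  + \sum_(i < K | (0 < s i)%N)
      (mu * (a == i.+1 :> nat)%:R
         * (s' == add_state (sub_state s (unit_state K i.+1))
                            (unit_state K i))%:R
       + (s i)%:R * theta * (s' == sub_state s (unit_state K i.+1))%:R).

Definition reward (s : state K) (a : action K) : R := mu * (a == 1%N :> nat)%:R.

End Model.

(* [rho pi t s] is the distribution of the action chosen at time [t] in
   state [s]. *)
Record policy (R : realType) (K : nat) := Policy {
  rho :> R -> state K -> action K -> R;
  rho_ge0 : forall (t : R) s a, 0 <= t -> 0 <= rho t s a;
  rho_feasible : forall (t : R) s a, 0 <= t -> a \notin feasible s -> rho t s a = 0;
  rho_sum1 : forall (t : R) s, 0 <= t -> \sum_(a in feasible s) rho t s a = 1;
  rho_measurable : forall (s : state K) (a : action K),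
    measurable_fun `[0 : R, +oo[%classic (fun t : R => rho t s a) }.

Section Control.
Context {R : realType} (K : nat) (lambda theta mu : R).

Definition policy_rate (pi : policy R K) (t : R) (s s' : state K) : R :=
  \sum_(a in feasible s) rate lambda theta mu a s s' * pi t s a.

Definition policy_reward (pi : policy R K) (t : R) (s : state K) : R :=
  \sum_(a in feasible s) reward mu s a * pi t s a.

(* A realization of the chain [X^pi] started at [s].  One exists for every [pi]:
   the rates out of a state are bounded uniformly in time, and only arrivals, at
   rate [lambda], increase the number of customers, so there is no explosion.
   The law of the chain, hence its throughput, does not depend on the
   realization. *)
Record controlled_chain (pi : policy R K) (s : state K) := ControlledChain {
  chain_display : measure_display;
  chain_space : measurableType chain_display;
  chain_prob : probability chain_space R;
  chain :> R -> chain_space -> state K;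
  chainP : is_markov_chain (policy_rate pi) s chain_prob chain }.

Definition total_reward (pi : policy R K) (s : state K)
    (X : controlled_chain pi s) (T : R) (w : chain_space X) : R :=
  \int[lebesgue_measure]_(t in `[0, T]) policy_reward pi t (X t w).

Definition throughput (pi : policy R K) (s : state K)
    (X : controlled_chain pi s) : \bar R :=
  limf_einf
    (fun T : R => (T^-1)%:E * 'E_(chain_prob X)[@total_reward pi s X T])%E +oo%R.

End Control.

Section SREPT.
Context (R : realType) (K : nat).

Definition srept_action (s : state K) : action K :=
  if [pick i : 'I_K | (0 < s i)%N
        && [forall j : 'I_K, (0 < s j)%N ==> (i <= j)%N]] is Some i
  then lift ord0 i else ord0.

Lemma srept_action_feasible (s : state K) : srept_action s \in feasible s.
Proof.
rewrite /srept_action inE; case: pickP => [i /andP[si _]|_]; last by rewrite eqxx.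
by apply/orP; right; apply/existsP; exists i; rewrite si andbT lift0.
Qed.

Definition srept_rho (t : R) (s : state K) (a : action K) : R :=
  (a == srept_action s)%:R.

Lemma srept_rho_ge0 (t : R) s a : 0 <= t -> 0 <= srept_rho t s a.
Proof. by move=> _; rewrite /srept_rho ler0n. Qed.

Lemma srept_rho_feasible (t : R) s a :
  0 <= t -> a \notin feasible s -> srept_rho t s a = 0.
Proof.
move=> _; rewrite /srept_rho; case: eqP => // ->.
by rewrite srept_action_feasible.
Qed.

Lemma srept_rho_sum1 (t : R) s :
  0 <= t -> \sum_(a in feasible s) srept_rho t s a = 1.
Proof.
move=> _; rewrite (bigD1 (srept_action s)) ?srept_action_feasible//=.
rewrite {1}/srept_rho eqxx big1 ?addr0// => a /andP[_ /negPf].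
by rewrite /srept_rho => ->.
Qed.

Lemma srept_rho_measurable (s : state K) (a : action K) :
  measurable_fun `[0 : R, +oo[%classic (fun t : R => srept_rho t s a).
Proof. exact: measurable_cst. Qed.

Definition srept : policy R K :=
  Policy srept_rho_ge0 srept_rho_feasible srept_rho_sum1 srept_rho_measurable.

End SREPT.

(* Main.v *)
Require Import Defs.
From mathcomp Require Import all_boot all_order all_algebra.
From mathcomp Require Import all_classical all_reals all_analysis.
From mathcomp Require Import measurable_realfun ring lra zify.
Import Order.TTheory GRing.Theory Num.Theory.
Local Open Scope classical_set_scope.
Local Open Scope ring_scope.
Set Implicit Arguments.
Unset Strict Implicit.
Unset Printing Implicit Defensive.
Import numFieldNormedType.Exports.

(* Fix a horizon [T].  For a policy [pi], let [V u x] be the mean number of service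
   completions on [[u, T]] plus the mean number of customers present at [T], from
   [x] at time [u], and let [z u x = |x| - V u x].  Paying for the customers left at
   [T] makes [z T = 0], while [z] follows the backward equation of the chain with
   running cost [theta |x| - lambda].  Under SREPT, [z] satisfies the four families
   of linear inequalities [ineq]: they are trivial at [T], and wherever one of them
   is tight the others make it improve backward in time, so that a maximum principle
   propagates them to [[0, T]].  Among their consequences, serving the customer with
   the fewest remaining phases minimizes [z], i.e. SREPT satisfies the
   Hamilton-Jacobi-Bellman equation, and the maximum principle gives
   [z^SREPT <= z^pi] for every [pi].  As at most [|s| + lambda / theta] customers are
   expected at [T], the terminal term disappears after division by [T]. *)

(** * States of the queue *)

Section States.
Context (K : nat).
Implicit Types (s x y : state K) (i j k : nat).
Local Notation e := (unit_state K).
Local Notation "s :+ x" := (add_state s x) (at level 50, left associativity).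
Local Notation "s :- x" := (sub_state s x) (at level 50, left associativity).

(** Two obstacles shape the proof. Abandonment rates grow with the number of customers and policies
    are only measurable in time, so [z] need have neither a time derivative nor a worst state.
    One-step expansions on [[u, v]], with an error quadratic in [v - u] and uniform on each level of
    at most [n] customers, replace derivatives; a quadratic weight, which beats the linear growth of
    [z], replaces the worst state. This requires one growth constant for all levels, so the
    unbounded departure rate [theta * n] must never multiply the tolerance itself. The four families
    are what closes the system. Service terms reproduce [Delay] or [Interchange] at index [i - 1].
    In [Interchange] the two-customer states lose customers at rate [2 * theta], while the margin,
    made of one-customer states, decays only at rate [theta]: [Delay] bounds the deficit. At [i = 1]
    the index cannot go down, but one state of the pair then has an extra customer, whose
    abandonment cost pays for the constant 1 of [Lipschitz]. *)

Definition customers s : nat := (\sum_i s i)%N.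

(* As [unit_state K 0] is the zero vector, [serve s 0 = s]. *)
Definition serve s k : state K := (s :- e k) :+ e k.-1.

Definition below s i := [forall l : 'I_K, (l.+1 < i)%N ==> (s l == 0%N)].

Lemma belowP s i :
  reflect (forall l : 'I_K, (l.+1 < i)%N -> s l = 0%N) (below s i).
Proof.
apply: (iffP forallP) => H l; first by move=> li; apply/eqP/(implyP (H l)).
by apply/implyP => /H ->.
Qed.

Lemma add_stateC s x : s :+ x = x :+ s.
Proof. by apply/ffunP => l; rewrite !ffunE addnC. Qed.

Lemma add_stateA s x y : s :+ (x :+ y) = s :+ x :+ y.
Proof. by apply/ffunP => l; rewrite !ffunE addnA. Qed.

Lemma add_stateAC s x y : s :+ x :+ y = s :+ y :+ x.
Proof. by rewrite -!add_stateA (add_stateC x). Qed.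

Lemma add_unit0 s : s :+ e 0 = s.
Proof. by apply/ffunP => l; rewrite !ffunE addn0. Qed.

Lemma sub_unit0 s : s :- e 0 = s.
Proof. by apply/ffunP => l; rewrite !ffunE subn0. Qed.

Lemma serve0 s : serve s 0 = s.
Proof. by rewrite /serve sub_unit0 add_unit0. Qed.

Lemma add_sub_unit s (l : 'I_K) x : (0 < s l)%N ->
  (s :+ x) :- e l.+1 = (s :- e l.+1) :+ x.
Proof.
move=> sl; apply/ffunP => m; rewrite !ffunE.
by case: eqP => [[/val_inj ->]|_]; lia.
Qed.

Lemma add_unitK s k : (s :+ e k) :- e k = s.
Proof. by apply/ffunP => m; rewrite !ffunE addnK. Qed.

Lemma sub_unitK s (l : 'I_K) : (0 < s l)%N -> (s :- e l.+1) :+ e l.+1 = s.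
Proof. by move=> sl; rewrite -add_sub_unit// add_unitK. Qed.

Lemma serve_add s (l : 'I_K) x : (0 < s l)%N ->
  serve (s :+ x) l.+1 = serve s l.+1 :+ x.
Proof. by move=> sl; rewrite /serve add_sub_unit// add_stateAC. Qed.

Lemma serve_unit s k : serve (s :+ e k) k = s :+ e k.-1.
Proof. by rewrite /serve add_unitK. Qed.

Lemma customers_add s x : customers (s :+ x) = (customers s + customers x)%N.
Proof. by rewrite /customers -big_split; apply: eq_bigr => l _; rewrite ffunE. Qed.

Lemma customers_unit k : customers (e k) = (0 < k <= K)%N.
Proof.
rewrite /customers; case: (boolP (0 < k <= K)%N) => kK.
  have kK' : (k.-1 < K)%N by lia.
  rewrite (bigD1 (Ordinal kK'))//= big1 ?ffunE /=; first by lia.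
  by move=> l lk; rewrite ffunE; case: eqP => // lk1; case/eqP: lk; apply: val_inj => /=; lia.
by apply: big1 => l _; rewrite ffunE; move: (ltn_ord l); lia.
Qed.

Lemma customers_unit_le s k : (customers (s :+ e k) <= (customers s).+1)%N.
Proof. by rewrite customers_add customers_unit; lia. Qed.

Lemma customers_sub s (l : 'I_K) : (0 < s l)%N ->
  customers (s :- e l.+1) = (customers s).-1.
Proof.
move=> sl; rewrite -{2}(sub_unitK sl) customers_add customers_unit.
by move: (ltn_ord l); lia.
Qed.

Lemma customers_gt0 s (l : 'I_K) : (0 < s l)%N -> (0 < customers s)%N.
Proof. by move=> sl; rewrite /customers (bigD1 l)//=; lia. Qed.

Lemma customers_serve s (l : 'I_K) : (0 < s l)%N ->
  customers (serve s l.+1) = (customers s - (l == 0 :> nat))%N.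
Proof.
move=> sl; rewrite /serve customers_add customers_unit customers_sub//=.
by move: (ltn_ord l) (customers_gt0 sl); lia.
Qed.

Lemma below_le s i j : (i <= j)%N -> below s j -> below s i.
Proof. by move=> ij /belowP sj; apply/belowP => l li; apply: sj; lia. Qed.

Lemma below_add s i k : (i <= k)%N -> below s i -> below (s :+ e k) i.
Proof. by move=> ik /belowP si; apply/belowP => l li; rewrite !ffunE si//; lia. Qed.

Lemma below_sub s i k : below s i -> below (s :- e k) i.
Proof. by move=> /belowP si; apply/belowP => l li; rewrite !ffunE si//; lia. Qed.

Lemma srept_actionE s (l : 'I_K) : (0 < s l)%N -> below s l.+1 ->
  srept_action s = l.+1 :> nat.
Proof.
move=> sl /belowP bl; rewrite /srept_action; case: pickP => [i|/(_ l)].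
  move=> /andP[si /forallP/(_ l)]; rewrite sl /= => il.
  suff -> : i = l by exact: lift0.
  apply/val_inj/eqP; rewrite eqn_leq il /= leqNgt.
  by apply/negP => il'; move: si; rewrite bl.
rewrite sl /=; case: forallP => //; case=> j; apply/implyP => sj.
by rewrite leqNgt; apply/negP => jl; move: sj; rewrite bl.
Qed.

Lemma srept_actionP s :
  (srept_action s = 0%N :> nat /\ forall i, below s i) \/
  exists2 l : 'I_K, (0 < s l)%N & below s l.+1.
Proof.
rewrite /srept_action; case: pickP => [l|H].
  move=> /andP[sl /forallP H]; right; exists l => //; apply/belowP => m ml.
  by apply/eqP; rewrite -leqn0 leqNgt; apply/negP => sm; have := H m; rewrite sm; lia.
left; split=> // i; apply/belowP => l _; apply/eqP; rewrite -leqn0 leqNgt.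
apply/negP => sl; case: (arg_minnP (P := fun l : 'I_K => (0 < s l)%N) (fun l : 'I_K => l : nat) sl).
move=> m sm mm; move: (H m); rewrite sm /= => /negP; apply.
by apply/forallP => j; apply/implyP => /mm.
Qed.

Lemma srept_action_unit s k : (0 < k <= K)%N -> below s k ->
  srept_action (s :+ e k) = k :> nat.
Proof.
move=> kK bk; have kK' : (k.-1 < K)%N by lia.
rewrite (@srept_actionE _ (Ordinal kK')) /=; first by lia.
  by rewrite !ffunE /=; lia.
by rewrite prednK; [exact: below_add|lia].
Qed.

Lemma srept_action_add s (l : 'I_K) k : (0 < s l)%N -> below s l.+1 ->
  (l < k)%N -> srept_action (s :+ e k) = l.+1 :> nat.
Proof.
by move=> sl bl lk; apply: srept_actionE; [rewrite ffunE; lia|exact: below_add].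
Qed.

Lemma feasibleP s (a : action K) : a \in feasible s ->
  a = 0%N :> nat \/ exists2 l : 'I_K, a = l.+1 :> nat & (0 < s l)%N.
Proof.
rewrite inE => /orP[/eqP->|/existsP[l /andP[/eqP al sl]]]; first by left.
by right; exists l.
Qed.

End States.

Ltac nlia :=
  repeat match goal with
  | H : is_true (leq _ _) |- _ => revert H
  | H : is_true (leq _ _ && _) |- _ => revert H
  | H : @eq nat _ _ |- _ => revert H
  | H : is_true (~~ (@eq_op _ _ _)) |- _ => revert H
  end; clear; lia.
Ltac clra :=
  repeat match goal with
  | H : is_true (Order.le _ _) |- _ => revert H
  | H : is_true (Order.lt _ _) |- _ => revert H
  end; lra.

(** * Propagation of the structural inequalities *)

Section Propagation.
Context (R : realFieldType) (K : nat) (lambda theta mu : R).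
Hypotheses (lambda_ge0 : 0 <= lambda) (theta_ge0 : 0 <= theta) (mu_gt0 : 0 < mu).
Implicit Types (s x y : state K) (i j k : nat) (z f g : state K -> R).
Local Notation e := (unit_state K).
Local Notation "s :+ x" := (add_state s x) (at level 50, left associativity).
Local Notation "s :- x" := (sub_state s x) (at level 50, left associativity).

(** Arrivals and abandonments: the part of the generator that does not depend on the action. *)
Definition background f s : R :=
  lambda * (f (s :+ e K) - f s)
  + theta * \sum_(l < K) (s l)%:R * (f (s :- e l.+1) - f s).

Definition cost_gen k z s : R :=
  theta * (customers s)%:R - lambda + background z s
  + mu * (z (serve s k) - z s).

Definition srept_gen z s : R := cost_gen (srept_action s) z s.

Lemma backgroundD a f b g s :
  background (fun x => a * f x + b * g x) s
  = a * background f s + b * background g s.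
Proof.
rewrite /background.
have -> : \sum_(l < K) (s l)%:R * (a * f (s :- e l.+1) + b * g (s :- e l.+1)
                                 - (a * f s + b * g s))
  = a * \sum_(l < K) (s l)%:R * (f (s :- e l.+1) - f s)
    + b * \sum_(l < K) (s l)%:R * (g (s :- e l.+1) - g s).
  by rewrite !mulr_sumr -big_split /=; apply: eq_bigr => l _; ring.
by ring.
Qed.

Lemma background_cst c s : background (fun=> c) s = 0.
Proof.
by rewrite /background subrr mulr0 add0r big1 ?mulr0// => l _; rewrite mulr0.
Qed.

Lemma background_ge f s a b : f (s :+ e K) >= a ->
  (forall l : 'I_K, (0 < s l)%N -> f (s :- e l.+1) >= b) ->
  background f s >= lambda * (a - f s) + theta * (customers s)%:R * (b - f s).
Proof.
move=> fa fb; rewrite /background -mulrA lerD//.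
  by apply: ler_wpM2l => //; rewrite lerD2r.
apply: ler_wpM2l => //; rewrite /customers natr_sum mulr_suml; apply: ler_sum => l _.
have [->|sl] := posnP (s l); first by rewrite !mul0r.
by apply: ler_wpM2l => //; rewrite lerD2r fb.
Qed.

(** Transitions of [s] commute with adding [e k]; the added customer contributes only its own
    abandonment, which leads back to [s]. For [k = 0] that last term vanishes. *)
Lemma background_unit f s k : (k <= K)%N ->
  background f (s :+ e k)
  = background (fun x => f (x :+ e k)) s + theta * (f s - f (s :+ e k)).
Proof.
move=> kK; rewrite /background (add_stateAC s) -addrA -mulrDr; congr (_ + _ * _).
have [->|k0] := posnP k.
  rewrite add_unit0 subrr addr0; apply: eq_bigr => l _.
  by rewrite !add_unit0.
have kK' : (k.-1 < K)%N by lia.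
have -> : f s - f (s :+ e k)
    = \sum_(l < K) (l.+1 == k)%:R * (f (s :+ e k :- e l.+1) - f (s :+ e k)).
  rewrite (bigD1 (Ordinal kK'))//= big1 ?addr0 ?prednK// ?eqxx ?add_unitK ?mul1r//.
  move=> l lk; case: eqP => [lk1|]; rewrite ?mul0r//; case/eqP: lk.
  by apply: val_inj => /=; lia.
rewrite -big_split; apply: eq_bigr => l _ /=.
rewrite !ffunE natrD mulrDl; congr (_ + _).
have [->|sl] := posnP (s l); first by rewrite !mul0r.
by rewrite add_sub_unit.
Qed.

Lemma cost_gen_unit a z s k : (k <= K)%N ->
  cost_gen a z (s :+ e k)
  = theta * (customers s)%:R + theta * (0 < k)%:R - lambda
    + background (fun x => z (x :+ e k)) s + theta * (z s - z (s :+ e k))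
    + mu * (z (serve (s :+ e k) a) - z (s :+ e k)).
Proof.
move=> kK; rewrite /cost_gen background_unit// customers_add customers_unit kK andbT.
by rewrite natrD; ring.
Qed.

Lemma cost_gen_unit2 a z s k j : (k <= K)%N -> (j <= K)%N ->
  cost_gen a z (s :+ e k :+ e j)
  = theta * (customers s)%:R + theta * (0 < k)%:R + theta * (0 < j)%:R - lambda
    + background (fun x => z (x :+ e k :+ e j)) s
    + theta * (z (s :+ e j) - z (s :+ e k :+ e j))
    + theta * (z (s :+ e k) - z (s :+ e k :+ e j))
    + mu * (z (serve (s :+ e k :+ e j) a) - z (s :+ e k :+ e j)).
Proof.
move=> kK jK; rewrite cost_gen_unit// customers_add customers_unit kK andbT natrD.
by rewrite (background_unit (fun x => z (x :+ e j)))//; ring.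
Qed.

(* When [s] has no customer with fewer than [i] phases, SREPT serves [e_i] in the
   state [s + e_i + e_j].  [Interchange] says that this beats serving [e_j], by a
   margin which is nonnegative by [Monotone]; the margin is what lets the
   inequality survive abandonments of the customer in service. *)
Inductive ineq :=
| Lipschitz (j : nat) (s : state K)
| Monotone (i : nat) (s : state K)
| Delay (i j : nat) (s : state K)
| Interchange (i j : nat) (s : state K).

Definition ineq_base (k : ineq) : state K :=
  match k with
  | Lipschitz _ s | Monotone _ s | Delay _ _ s | Interchange _ _ s => s
  end.

Definition ineq_ok (k : ineq) : bool :=
  match k with
  | Lipschitz j _ => 0 < j <= K
  | Monotone i _ => 0 < i <= K
  | Delay i j s | Interchange i j s => [&& 0 < i, i < j, j <= K & below s i]
  end%N.

Definition ineq_lin (k : ineq) z : R :=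
  match k with
  | Lipschitz j s => z s - z (s :+ e j)
  | Monotone i s => z (s :+ e i) - z (s :+ e i.-1)
  | Delay i j s => mu * (z (s :+ e i) - z (s :+ e i.-1))
                   - theta * (z (s :+ e j) - z (s :+ e i))
  | Interchange i j s =>
      mu * (z (s :+ e i :+ e j.-1) - z (s :+ e i.-1 :+ e j))
      - theta * (z (s :+ e j) - z (s :+ e i))
  end.

Definition ineq_val (k : ineq) z : R :=
  (if k is Lipschitz _ _ then 1 else 0) + ineq_lin k z.

(** Moving the base turns an inequality into a function of the base state, to which [background] can
    be applied. *)
Definition ineq_at (k : ineq) x : ineq :=
  match k with
  | Lipschitz j _ => Lipschitz j x
  | Monotone i _ => Monotone i x
  | Delay i j _ => Delay i j x
  | Interchange i j _ => Interchange i j x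
  end.

Lemma ineq_baseK (k : ineq) : ineq_at k (ineq_base k) = k.
Proof. by case: k. Qed.

Lemma ineq_base_at (k : ineq) x : ineq_base (ineq_at k x) = x.
Proof. by case: k. Qed.

(** An arriving customer has [K] phases, and [K >= i], so [below s i] survives. *)
Lemma ineq_ok_arrival (k : ineq) :
  ineq_ok k -> ineq_ok (ineq_at k (ineq_base k :+ e K)).
Proof.
by case: k => //= i j s /and4P[i0 ij jK si]; rewrite /= i0 ij jK below_add//; lia.
Qed.

Lemma ineq_ok_departure (k : ineq) l :
  ineq_ok k -> ineq_ok (ineq_at k (ineq_base k :- e l)).
Proof.
by case: k => //= i j s /and4P[-> -> -> si]; rewrite /= below_sub.
Qed.

Section Tolerance.
Context (z : state K -> R) (N : nat) (t : R).
Hypothesis t_ge0 : 0 <= t.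
(** The maximum principle provides the inequalities only up to an error [t], and only on bounded
    levels. *)
Hypothesis zt : forall k : ineq, ineq_ok k -> (customers (ineq_base k) <= N)%N ->
  - t <= ineq_val k z.

Lemma lipschitz_tol j s : (0 < j <= K)%N -> (customers s <= N)%N ->
  z (s :+ e j) <= 1 + z s + t.
Proof. by move=> jK sN; have := zt (k := Lipschitz j s) jK sN; rewrite /ineq_val /=; lra. Qed.

Lemma monotone_tol i s : (0 < i <= K)%N -> (customers s <= N)%N ->
  z (s :+ e i.-1) <= z (s :+ e i) + t.
Proof. by move=> jK sN; have := zt (k := Monotone i s) jK sN; rewrite /ineq_val /=; lra. Qed.

Lemma monotone_tol_le i j s : (i <= j <= K)%N -> (customers s <= N)%N ->
  z (s :+ e i) <= z (s :+ e j) + K%:R * t.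
Proof.
move=> ijK sN; apply: (@le_trans _ _ (z (s :+ e j) + (j - i)%:R * t)); last first.
  by rewrite lerD2l; apply: ler_wpM2r => //; rewrite ler_nat; nlia.
elim: j ijK => [|j IH] ijK.
  have -> : i = 0%N by nlia.
  by rewrite subnn mul0r addr0; exact: lexx.
have [->|ij] := eqVneq i j.+1; first by rewrite subnn mul0r addr0 lexx.
have := IH ltac:(nlia); have := @monotone_tol j.+1 s ltac:(nlia) sN => /=.
have -> : (j.+1 - i = (j - i).+1)%N by nlia.
by rewrite -natr1; lra.
Qed.

Lemma delay_tol i j s : [&& 0 < i, i < j, j <= K & below s i]%N ->
  (customers s <= N)%N ->
  theta * (z (s :+ e j) - z (s :+ e i))
  <= mu * (z (s :+ e i) - z (s :+ e i.-1)) + t.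
Proof. by move=> ok sN; have := zt (k := Delay i j s) ok sN; rewrite /ineq_val /=; lra. Qed.

Lemma interchange_tol i j s : [&& 0 < i, i < j, j <= K & below s i]%N ->
  (customers s <= N)%N ->
  theta * (z (s :+ e j) - z (s :+ e i))
  <= mu * (z (s :+ e i :+ e j.-1) - z (s :+ e i.-1 :+ e j)) + t.
Proof. by move=> ok sN; have := zt (k := Interchange i j s) ok sN; rewrite /ineq_val /=; lra. Qed.

Variable tau : R.
(** [tau] is the loss in comparing two actions: [Interchange] costs [t], its margin may be negative
    by [theta * K * t], and the sum is divided by [mu]. *)
Hypotheses (t_tau : t <= tau) (mu_tau : (1 + theta * K%:R) * t <= mu * tau).

(** Against idling this is [Monotone]. Against a customer with more phases, remove both customers
    from [s] and apply [Interchange] to the rest; telescoping [Monotone] controls its margin. *)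
Lemma srept_serve_tol s (a : action K) : a \in feasible s -> (customers s <= N)%N ->
  z (serve s (srept_action s)) <= z (serve s a) + tau.
Proof.
move=> /feasibleP fa sN.
have [[-> s0]|[l sl bl]] := srept_actionP s.
  case: fa => [->|[m _ sm]]; first by rewrite serve0 lerDl (le_trans t_ge0).
  by have /belowP/(_ m (ltnSn _)) := s0 m.+2; nlia.
rewrite (srept_actionE sl bl).
set s' := s :- e l.+1.
have s'N : (customers s' <= N)%N by rewrite customers_sub//; nlia.
have sE : s = s' :+ e l.+1 by rewrite sub_unitK.
case: fa => [->|[m -> sm]].
  rewrite serve0 [X in serve X]sE serve_unit [in X in _ <= X]sE /=.
  by have := @monotone_tol l.+1 s' ltac:(by rewrite ltn_ord) s'N; clra.
have [ml|ml|/val_inj ->] := ltngtP m l; last by clra.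
  by move: sm; rewrite (belowP _ _ bl).
have s'm : (0 < s' m)%N by rewrite ffunE ffunE eqSS gtn_eqF// subn0.
set s2 := s' :- e m.+1.
have s2N : (customers s2 <= N)%N by rewrite customers_sub//; nlia.
have s'E : s' = s2 :+ e m.+1 by rewrite sub_unitK.
rewrite sE serve_unit s'E serve_add; last first.
  by rewrite !ffunE eqxx addn1.
rewrite serve_unit /=.
have ok : [&& 0 < l.+1, l.+1 < m.+1, m.+1 <= K & below s2 l.+1]%N.
  by rewrite /= ltnS ml ltn_ord/= below_sub// below_sub.
have := interchange_tol ok s2N; rewrite /=.
have := @monotone_tol_le l.+1 m.+1 s2 ltac:(by rewrite ltnS (ltnW ml) ltn_ord) s2N.
rewrite (add_stateAC s2 (e m.+1)) (add_stateAC s2 (e m) (e l.+1)).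
set A := z (s2 :+ e l.+1 :+ e m); set B := z (s2 :+ e l :+ e m.+1).
move=> h1 h2.
have h3 : - (theta * (K%:R * t)) <= mu * (A - B) + t.
  apply: le_trans h2; rewrite -mulrN; apply: ler_wpM2l => //; clra.
have h4 : B - A <= tau by rewrite -(ler_pM2l mu_gt0); clra.
clra.
Qed.

Lemma customers_srept s : (customers (serve s (srept_action s)) <= customers s)%N.
Proof.
have [[-> _]|[l sl bl]] := srept_actionP s; first by rewrite serve0.
by rewrite (srept_actionE sl bl) customers_serve//; nlia.
Qed.

Lemma srept_feasible_unit s j : (0 < j <= K)%N ->
  exists2 a : action K, a = j :> nat & a \in feasible (s :+ e j).
Proof.
move=> jK; have jK1 : (j < K.+1)%N by nlia.
have jK2 : (j.-1 < K)%N by nlia.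
exists (Ordinal jK1) => //; rewrite inE; apply/orP; right.
apply/existsP; exists (Ordinal jK2); rewrite !ffunE /= prednK ?eqxx; last by nlia.
by rewrite addn1.
Qed.

Lemma feasible0 s : ord0 \in feasible s.
Proof. by rewrite inE eqxx. Qed.

Lemma srept_feasible_add s x : srept_action s \in feasible (s :+ x).
Proof.
have := srept_action_feasible s; rewrite !inE => /orP[->//|/existsP[l /andP[al sl]]].
by apply/orP; right; apply/existsP; exists l; rewrite al ffunE /=; nlia.
Qed.

Lemma serve_srept_add s x :
  serve (s :+ x) (srept_action s) = serve s (srept_action s) :+ x.
Proof.
have [[-> _]|[l sl bl]] := srept_actionP s; first by rewrite !serve0.
by rewrite (srept_actionE sl bl) serve_add.
Qed.

(** When [s] already holds a customer with fewer than [i] phases, adding [e i] or [e i.-1] does not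
    change whom SREPT serves, so both states of [Monotone] can be run with the same action. *)
Lemma srept_action_gt s i : (0 < i <= K)%N -> ~~ below s i ->
  forall k, (i.-1 <= k)%N -> srept_action (s :+ e k) = srept_action s.
Proof.
move=> iK nb k ik; have [[_ /(_ i)]|[l sl bl]] := srept_actionP s.
  by rewrite (negbTE nb).
have li : (l < i.-1)%N.
  rewrite ltnNge; apply/negP => il; move/negP: nb; apply; apply: below_le bl; nlia.
by apply/val_inj; rewrite /= (srept_actionE sl bl) (srept_action_add sl bl)//; nlia.
Qed.

Section Step.
Variables (n : nat) (t0 eta : R).
Hypotheses (Nn : N = n.+1) (eta_ge0 : 0 <= eta).
Hypothesis zt0 : forall k : ineq, ineq_ok k -> (customers (ineq_base k) <= n)%N ->
  - t0 <= ineq_val k z.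

(** Arrivals lead to level [n.+1], known up to [t]; departures stay at or below level [n], known up
    to [t0]. As [t0 + ineq_val k z <= eta], the unbounded rate [theta * n] multiplies only [eta]. *)
Lemma background_ineq (k : ineq) : ineq_ok k -> customers (ineq_base k) = n ->
  ineq_val k z <= eta -> t0 + ineq_val k z <= eta ->
  - (lambda * (t + eta) + theta * n%:R * eta)
  <= background (fun x => ineq_val (ineq_at k x) z) (ineq_base k).
Proof.
move=> ok kn v1 v2.
apply: le_trans (@background_ge _ (ineq_base k) (- t) (- t0) _ _); first last.
- move=> l sl; apply: zt0; first exact: ineq_ok_departure.
  by rewrite ineq_base_at customers_sub//; nlia.
- apply: zt; first exact: ineq_ok_arrival.
  by rewrite ineq_base_at customers_add customers_unit kn Nn; nlia.
rewrite ineq_baseK kn opprD -!mulrN; apply: lerD.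
  by apply: ler_wpM2l => //; move: v1; lra.
by apply: ler_wpM2l; [rewrite mulr_ge0|move: v2; lra].
Qed.

(** The worst coefficient of [tau] over the four steps: [lambda] from arrivals, the rest from
    comparisons multiplied by [mu], [theta], [mu * mu] or [mu * theta]. Its independence of [n] is
    what matters. *)
Definition step_cst : R := lambda + theta + mu *+ 2 + mu * (mu + theta *+ 2).
Definition step_slack : R :=
  (lambda + theta *+ 2 + mu + theta * n%:R) * eta + step_cst * tau.

Lemma posn k : (0 < k <= K)%N -> (0 < k)%:R = 1 :> R.
Proof. by case: k. Qed.

(** Besides [background], abandonment of the added customers and the diagonal part of service
    contribute [- c] times the inequality itself; this is harmless because its value is at most
    [eta]. *)
Lemma slack_ge (B c v : R) : 0 <= c <= theta *+ 2 + mu -> v <= eta ->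
  - (lambda * (t + eta) + theta * n%:R * eta) <= B ->
  - step_slack <= B - c * v - (step_cst - lambda) * tau.
Proof.
move=> /andP[c0 c1] xe hB.
have h1 : c * v <= (theta *+ 2 + mu) * eta.
  by apply: le_trans (ler_wpM2l c0 xe) _; apply: ler_wpM2r.
have h2 : lambda * t <= lambda * tau by apply: ler_wpM2l.
by rewrite /step_slack; move: h1 h2 hB; lra.
Qed.

Lemma theta_mu : 0 <= theta + mu <= theta *+ 2 + mu.
Proof. by apply/andP; split; move: theta_ge0 mu_gt0; lra. Qed.

Lemma tolerance_products :
  [/\ 0 <= theta * tau, 0 <= mu * tau, 0 <= mu * mu * tau & 0 <= mu * theta * tau] /\
  [/\ theta * t <= theta * tau, mu * t <= mu * tau & mu * theta * t <= mu * theta * tau].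
Proof.
have tau0 := le_trans t_ge0 t_tau; have mu0 := ltW mu_gt0.
by do 2 split; rewrite ?mulr_ge0 ?ler_wpM2l ?mulr_ge0.
Qed.

(** In [s + e_j], copying the action taken in [s] keeps the states one customer apart, and SREPT
    does no worse up to [tau]. The running cost of the extra customer turns [- theta * ineq_lin]
    into [- theta * ineq_val]. *)
Lemma lipschitz_step j s : (0 < j <= K)%N -> customers s = n ->
  ineq_val (Lipschitz j s) z <= eta -> t0 + ineq_val (Lipschitz j s) z <= eta ->
  - step_slack <= ineq_lin (Lipschitz j s) (srept_gen z).
Proof.
move=> jK sn v1 v2; have := background_ineq (k := Lipschitz j s) jK sn v1 v2.
rewrite [X in background X _](_ : _ = (fun x => 1 * (fun=> 1) x + 1 *
    (fun y => 1 * z y + (- 1) * (fun y => z (y :+ e j)) y) x)); last first.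
  by apply/funext => x; rewrite /ineq_val /=; ring.
rewrite !backgroundD background_cst => hB.
have [a aj fa] := srept_feasible_unit s jK.
have T : z (serve (s :+ e j) (srept_action (s :+ e j)))
         <= 1 + z (serve s (srept_action s)) + t + tau.
  have s'N : (customers (serve s (srept_action s)) <= N)%N.
    by rewrite Nn (leq_trans (customers_srept s))// sn.
  have sjN : (customers (s :+ e j) <= N)%N.
    by rewrite customers_add customers_unit jK sn Nn addn1.
  have h1 := lipschitz_tol jK s'N.
  have := srept_serve_tol (srept_feasible_add s (e j)) sjN.
  by rewrite serve_srept_add; move: h1; lra.
have := @slack_ge _ (theta + mu) _ theta_mu v1 hB.
have {T}T := ler_wpM2l (ltW mu_gt0) T.
have [[p1 p2 p3 p4] [p5 p6 p7]] := tolerance_products.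
rewrite /= /srept_gen cost_gen_unit; last by nlia.
rewrite /cost_gen /ineq_val /= /step_cst (posn jK).
move: T p1 p2 p3 p4 p5 p6 p7; lra.
Qed.

Lemma srept_serve_below i s : (0 < i <= K)%N -> below s i ->
  serve (s :+ e i) (srept_action (s :+ e i)) = s :+ e i.-1.
Proof. by move=> iK si; rewrite (srept_action_unit iK si) serve_unit. Qed.

Lemma srept_serve_unit_tol j s : (0 < j <= K)%N -> (customers s <= n)%N ->
  z (serve (s :+ e j) (srept_action (s :+ e j))) <= z (s :+ e j.-1) + tau.
Proof.
move=> jK sn; have [a aj fa] := srept_feasible_unit s jK.
have sjN : (customers (s :+ e j) <= N)%N.
  by rewrite customers_add customers_unit jK Nn addn1.
by have := srept_serve_tol fa sjN; rewrite aj serve_unit.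
Qed.

Lemma srept_serve_idle_tol s : (customers s <= N)%N ->
  z (serve s (srept_action s)) <= z s + tau.
Proof. by move=> sN; have := srept_serve_tol (feasible0 s) sN; rewrite serve0. Qed.

Lemma posn_le1 k : theta * (0 < k)%:R <= theta.
Proof. by rewrite ler_piMr// lern1 leq_b1. Qed.

(** If [e_i] is served, it becomes [e_{i-1}], and the other state can idle. Otherwise both states
    serve the same customer of [s], and [Monotone] applies again after that service. *)
Lemma monotone_step i s : (0 < i <= K)%N -> customers s = n ->
  ineq_val (Monotone i s) z <= eta -> t0 + ineq_val (Monotone i s) z <= eta ->
  - step_slack <= ineq_lin (Monotone i s) (srept_gen z).
Proof.
move=> iK sn v1 v2; have := background_ineq (k := Monotone i s) iK sn v1 v2.
rewrite [X in background X _](_ : _ = (fun x => 1 * (fun y => z (y :+ e i)) x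
    + (- 1) * (fun y => z (y :+ e i.-1)) x)); last first.
  by apply/funext => x; rewrite /ineq_val /=; ring.
rewrite backgroundD => hB.
have T : z (serve (s :+ e i.-1) (srept_action (s :+ e i.-1)))
         <= z (serve (s :+ e i) (srept_action (s :+ e i))) + t + tau.
  have [si|nsi] := boolP (below s i).
    rewrite (srept_serve_below iK si).
    have sN : (customers (s :+ e i.-1) <= N)%N.
      by rewrite Nn -sn; exact: customers_unit_le.
    by have := srept_serve_idle_tol sN; move: t_ge0; lra.
  rewrite !(srept_action_gt iK nsi) ?leq_pred// !serve_srept_add.
  have s'N : (customers (serve s (srept_action s)) <= N)%N.
    by rewrite Nn (leq_trans (customers_srept s))// sn.
  by have := monotone_tol iK s'N; move: t_tau t_ge0; lra.
have := @slack_ge _ (theta + mu) _ theta_mu v1 hB.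
have {}T := ler_wpM2l (ltW mu_gt0) T.
have [[p1 p2 p3 p4] [p5 p6 p7]] := tolerance_products.
have q := posn_le1 i.-1.
rewrite /= /srept_gen !cost_gen_unit; [|nlia..].
rewrite /ineq_val /= /step_cst (posn iK).
move: T p1 p2 p3 p4 p5 p6 p7 q; lra.
Qed.

(** For [i > 1] the service terms are at least [mu] times [Delay] at [i - 1] and [j - 1]. SREPT need
    not serve [e_j] in [s + e_j], but an upper bound suffices there, since that term has a negative
    sign. *)
Lemma delay_step i j s : [&& 0 < i, i < j, j <= K & below s i]%N -> customers s = n ->
  ineq_val (Delay i j s) z <= eta -> t0 + ineq_val (Delay i j s) z <= eta ->
  - step_slack <= ineq_lin (Delay i j s) (srept_gen z).
Proof.
move=> ok sn v1 v2; have := background_ineq (k := Delay i j s) ok sn v1 v2.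
rewrite [X in background X _](_ : _ = (fun x =>
    mu * (fun y => 1 * (fun y => z (y :+ e i)) y + (- 1) * (fun y => z (y :+ e i.-1)) y) x
    + (- theta) * (fun y => 1 * (fun y => z (y :+ e j)) y
                            + (- 1) * (fun y => z (y :+ e i)) y) x)); last first.
  by apply/funext => x; rewrite /ineq_val /=; ring.
rewrite !backgroundD => hB.
have /and4P[i0 ij jK si] := ok.
have iK : (0 < i <= K)%N by nlia.
have j0K : (0 < j <= K)%N by nlia.
have sN : (customers s <= N)%N by rewrite sn Nn.
have mu0 := ltW mu_gt0; have mm := mulr_ge0 mu0 mu0.
have mt := mulr_ge0 mu0 theta_ge0.
have Tj := ler_wpM2l mt (srept_serve_unit_tol j0K (eq_leq sn)).
have [[p1 p2 p3 p4] [p5 p6 p7]] := tolerance_products.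
have := @slack_ge _ (theta + mu) _ theta_mu v1 hB.
rewrite /= /srept_gen !cost_gen_unit; [|nlia..].
rewrite (srept_serve_below iK si) /ineq_val /= /step_cst (posn iK) (posn j0K).
(* Here [s + e_{i-1}] is [s], one customer short of [s + e_1]: the cost difference, weighted to
   [mu * theta], pays for the 1 in [Lipschitz]. *)
have [i1|i1] := eqVneq i 1%N.
  rewrite i1 /= !add_unit0 in Tj *.
  have jK' : (0 < j.-1 <= K)%N by nlia.
  have h1 := ler_wpM2l mt (lipschitz_tol jK' sN).
  have h2 := ler_wpM2l mm (srept_serve_idle_tol sN).
  by move: Tj p1 p2 p3 p4 p5 p6 p7 h1 h2; rewrite mulr0n mulr0; lra.
have iK' : (0 < i.-1 <= K)%N by nlia.
have si' := below_le (leq_pred i) si.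
rewrite (srept_serve_below iK' si') (posn iK').
have ok' : [&& 0 < i.-1, i.-1 < j.-1, j.-1 <= K & below s i.-1]%N by rewrite si'; nlia.
have h1 := ler_wpM2l mu0 (delay_tol ok' sN).
by move: Tj p1 p2 p3 p4 p5 p6 p7 h1; lra.
Qed.

(** For [i > 1] SREPT serves [e_i] in one state of the pair and [e_{i-1}] in the other, which yields
    [mu] times [Interchange] at [i - 1] and the same [j], plus [mu * theta * (z (s + e_i) - z (s +
    e_{i-1}))]. *)
Lemma interchange_step i j s : [&& 0 < i, i < j, j <= K & below s i]%N ->
  customers s = n ->
  ineq_val (Interchange i j s) z <= eta -> t0 + ineq_val (Interchange i j s) z <= eta ->
  - step_slack <= ineq_lin (Interchange i j s) (srept_gen z).
Proof.
move=> ok sn v1 v2; have := background_ineq (k := Interchange i j s) ok sn v1 v2.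
rewrite [X in background X _](_ : _ = (fun x =>
    mu * (fun y => 1 * (fun y => z (y :+ e i :+ e j.-1)) y
                   + (- 1) * (fun y => z (y :+ e i.-1 :+ e j)) y) x
    + (- theta) * (fun y => 1 * (fun y => z (y :+ e j)) y
                            + (- 1) * (fun y => z (y :+ e i)) y) x)); last first.
  by apply/funext => x; rewrite /ineq_val /=; ring.
rewrite !backgroundD => hB.
have /and4P[i0 ij jK si] := ok.
have iK : (0 < i <= K)%N by nlia.
have j0K : (0 < j <= K)%N by nlia.
have j1K : (0 < j.-1 <= K)%N by nlia.
have sN : (customers s <= N)%N by rewrite sn Nn.
have mu0 := ltW mu_gt0; have mm := mulr_ge0 mu0 mu0.
have mt := mulr_ge0 mu0 theta_ge0.
have Tj := srept_serve_unit_tol j0K (eq_leq sn).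
have Tj1 := ler_wpM2l mt Tj.
(* The margin decays at rate [theta] less than the pair; the missing
   [theta ^ 2 * (z (s + e_j) - z (s + e_i))] is bounded by [theta] times [Delay]. *)
have h0 := ler_wpM2l theta_ge0 (delay_tol ok sN).
have Tb : serve (s :+ e i :+ e j.-1) (srept_action (s :+ e i :+ e j.-1))
          = s :+ e i.-1 :+ e j.-1.
  rewrite (add_stateAC s (e i)) srept_serve_below//; first by rewrite add_stateAC.
  by apply: below_add => //; nlia.
have [[p1 p2 p3 p4] [p5 p6 p7]] := tolerance_products.
have := @slack_ge _ (theta *+ 2 + mu) _ _ v1 hB; rewrite lexx andbT.
move=> /(_ ltac:(by rewrite addr_ge0// mulrn_wge0)).
rewrite /= /srept_gen !cost_gen_unit2; [|nlia..].
rewrite !cost_gen_unit; [|nlia..].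
rewrite Tb (srept_serve_below iK si) /ineq_val /= /step_cst.
rewrite (posn iK) (posn j0K) (posn j1K).
have [i1|i1] := eqVneq i 1%N.
  rewrite i1 /= !add_unit0 in Tj Tj1 h0 *.
  have h1 := ler_wpM2l mt (lipschitz_tol j0K sN).
  have h2 := ler_wpM2l mm Tj.
  by move: Tj1 p1 p2 p3 p4 p5 p6 p7 h0 h1 h2; rewrite mulr0n mulr0; lra.
have iK' : (0 < i.-1 <= K)%N by nlia.
have si' := below_le (leq_pred i) si.
have Ta : serve (s :+ e i.-1 :+ e j) (srept_action (s :+ e i.-1 :+ e j))
          = s :+ e i.-2 :+ e j.
  rewrite (add_stateAC s (e i.-1)) srept_serve_below//; first by rewrite add_stateAC.
  by apply: below_add => //; nlia.
rewrite Ta (posn iK').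
have ok' : [&& 0 < i.-1, i.-1 < j, j <= K & below s i.-1]%N by rewrite si'; nlia.
have h1 := ler_wpM2l mu0 (interchange_tol ok' sN).
by move: Tj1 p1 p2 p3 p4 p5 p6 p7 h0 h1; lra.
Qed.

Lemma ineq_step (k : ineq) : ineq_ok k -> customers (ineq_base k) = n ->
  ineq_val k z <= eta -> t0 + ineq_val k z <= eta ->
  - step_slack <= ineq_lin k (srept_gen z).
Proof.
case: k => [j s|i s|i j s|i j s] /=.
- exact: lipschitz_step.
- exact: monotone_step.
- exact: delay_step.
- exact: interchange_step.
Qed.

End Step.
End Tolerance.
End Propagation.

(** * Maximum principle *)

Section MaximumPrinciple.
Context (R : realType) (I : Type) (ok : I -> Prop) (size : I -> nat).
Context (T : R) (F : R -> I -> R).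

(** Quadratic, hence eventually above any linear growth, yet [weight n.+1 <= 4 * weight n], so an
    arrival costs only a constant factor. *)
Definition weight (n : nat) : R := n.+1%:R ^+ 2.

Lemma weight_ge1 n : 1 <= weight n.
Proof. by rewrite /weight exprn_ege1// ler1n. Qed.

Hypothesis F_growth : exists M : R, forall (u : R) k, 0 <= u <= T -> ok k ->
  - (M * (size k).+1%:R) <= F u k.
Hypothesis F_end : forall k, ok k -> 0 <= F T k.
Hypothesis F_lip : forall N, exists L : R, forall k (u v : R),
  ok k -> (size k <= N)%N -> 0 <= u -> u <= v -> v <= T ->
  - (L * (v - u)) <= F u k - F v k.
Hypothesis F_step : exists Gamma : R, forall N, exists B : R,
  forall k (u v p eta : R),
  ok k -> (size k <= N)%N -> 0 <= u -> u <= v -> v <= T -> 0 <= p -> 0 <= eta ->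
  (forall k', ok k' -> - (p * weight (size k')) <= F v k') ->
  F v k <= - (p * weight (size k)) + eta ->
  - ((Gamma * (p * weight (size k)) + B * (eta + (v - u))) * (v - u))
  <= F u k - F v k.

(* If [F v >= - p weight], then one step back in time [p] grows at most by the
   factor [1 + (|Gamma| + 1) (v - u)]: far out this is the growth bound, and
   elsewhere either [F v k] is too large to matter or [F_step] applies. *)
Theorem maximum_principle (u : R) k : 0 <= u <= T -> ok k -> 0 <= F u k.
Proof.
have [M F_gr] := F_growth; have [Gamma FG] := F_step.
move=> /andP[u0 uT] okk.
(* The additional 1 absorbs the error term [B * (eta + (v - u))], kept below [p * weight] by small
   steps. *)
pose G : R := `|Gamma| + 1; have G0 : 0 < G by rewrite ltr_wpDl.
suff main (eps : R) : 0 < eps -> - (eps * (expR (G * (T - u)) * weight (size k))) <= F u k.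
  rewrite leNgt; apply/negP => Fu.
  have c0 : 0 < expR (G * (T - u)) * weight (size k).
    by rewrite mulr_gt0 ?expR_gt0// (lt_le_trans ltr01)// weight_ge1.
  (* For this [eps] the lower bound is half of the negative [F u k], a contradiction. *)
  have := main (- F u k / (expR (G * (T - u)) * weight (size k)) / 2).
  rewrite divr_gt0 ?divr_gt0 ?oppr_gt0// => /(_ isT).
  set c := expR _ * _ in c0 *.
  have -> : - F u k / c / 2 * c = - F u k / 2 by field; rewrite gt_eqF.
  by move: Fu; lra.
move=> eps0.
(* Beyond size [N] the growth bound already lies above [- eps * weight]. *)
pose N := (Num.truncn (`|M| / eps)).+1.
have MN : `|M| <= eps * N%:R.
  by rewrite mulrC -ler_pdivrMr//; exact: (ltW (truncnS_gt _)).
have [L FL] := F_lip N; have [B FB] := FG N.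
pose C : R := `|B| * (`|L| + 1) + 1; have C0 : 0 < C.
  by rewrite ltr_wpDl// mulr_ge0// addr_ge0.
have step (p v w : R) : eps <= p -> 0 <= w -> w <= v -> v <= T -> (v - w) * C <= eps ->
    (forall k', ok k' -> - (p * weight (size k')) <= F v k') ->
    forall k', ok k' -> - (p * (1 + G * (v - w)) * weight (size k')) <= F w k'.
  move=> pe w0 wv vT hC Fv j okj.
  have p0 : 0 < p := lt_le_trans eps0 pe.
  have h0 : 0 <= v - w by rewrite subr_ge0.
  have pp : p * weight (size j) <= p * (1 + G * (v - w)) * weight (size j).
    apply: ler_wpM2r; first exact: le_trans (weight_ge1 _).
    by rewrite ler_peMr ?(ltW p0)// lerDl mulr_ge0 ?(ltW G0).
  have [jN|Nj] := leqP (size j) N; last first.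
    apply: le_trans (F_gr w j _ okj); last by rewrite w0 (le_trans wv).
    rewrite lerN2; apply: le_trans pp.
    apply: (@le_trans _ _ (eps * N%:R * (size j).+1%:R)).
      by apply: ler_wpM2r => //; apply: le_trans MN; exact: ler_norm.
    rewrite -mulrA; apply: ler_pM => //; first by rewrite ltW.
    by rewrite /weight expr2; apply: ler_wpM2r => //; rewrite ler_nat (leq_trans (ltnW Nj)).
  (* [F] loses at most [|L| * (v - w)] over the step. Above this threshold nothing can go wrong;
     below it the threshold serves as [eta]. *)
  have [big|small] := leP (- (p * weight (size j)) + `|L| * (v - w)) (F v j).
    have := FL j w v okj jN w0 wv vT.
    have := ler_wpM2r h0 (ler_norm L).
    by move: big pp; lra.
  have := FB j w v p _ okj jN w0 wv vT (ltW p0) _ Fv (ltW small).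
  rewrite mulr_ge0// => /(_ isT).
  have h1 : Gamma * (p * weight (size j)) <= `|Gamma| * (p * weight (size j)).
    apply: ler_wpM2r (ler_norm _).
    by rewrite mulr_ge0 ?(ltW p0)//; exact: le_trans (weight_ge1 _).
  have h2 : B * (`|L| * (v - w) + (v - w)) <= p * weight (size j).
    apply: (@le_trans _ _ eps).
      apply: le_trans hC; rewrite -{2}[v - w]mul1r -mulrDl mulrA mulrC.
      apply: ler_wpM2l => //; rewrite /C; apply: (@le_trans _ _ (`|B| * (`|L| + 1))).
        by apply: ler_wpM2r; [rewrite addr_ge0|exact: ler_norm].
      by rewrite lerDl.
    by apply: (le_trans pe); rewrite ler_peMr ?(ltW p0)// weight_ge1.
  have := Fv j okj.
  have := ler_wpM2r h0 (lerD h1 h2).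
  rewrite /G; move: pp; lra.
(* Enough equal steps that each satisfies [h * C <= eps]; the growth factors then multiply to at
   most [expR (G * (T - u))]. *)
pose n := (Num.truncn ((T - u) * C / eps)).+1.
have n0 : (0 : R) < n%:R by rewrite ltr0n.
pose h := (T - u) / n%:R.
have h0 : 0 <= h by rewrite divr_ge0// subr_ge0.
have hC : h * C <= eps.
  rewrite /h mulrAC ler_pdivrMr// [eps * _]mulrC -ler_pdivrMr//.
  exact: (ltW (truncnS_gt _)).
have hn : h * n%:R = T - u by rewrite /h divfK// gt_eqF.
have iter m : (m <= n)%N -> forall k', ok k' ->
    - (eps * (1 + G * h) ^+ m * weight (size k')) <= F (T - h * m%:R) k'.
  elim: m => [_ k' okk'|m IH mn].
    rewrite mulr0 subr0; apply: le_trans (F_end okk').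
    by rewrite oppr_le0 !mulr_ge0 ?(ltW eps0)//; exact: le_trans (weight_ge1 _).
  have hm : h * m.+1%:R <= T - u by rewrite -hn ler_wpM2l// ler_nat.
  have e : T - h * m%:R - (T - h * m.+1%:R) = h by rewrite -natr1; ring.
  have := step (eps * (1 + G * h) ^+ m) (T - h * m%:R) (T - h * m.+1%:R).
  rewrite e exprSr mulrA; apply => //.
  - by rewrite ler_peMr ?(ltW eps0)// exprn_ege1// lerDl mulr_ge0 ?(ltW G0).
  - by move: hm u0; lra.
  - by rewrite lerD2l lerN2 ler_wpM2l// ler_nat.
  - by rewrite gerBl mulr_ge0.
  - by apply: IH; exact: ltnW.
have := iter n (leqnn _) k okk; rewrite hn subKr.
apply: le_trans; rewrite lerN2 -mulrA; apply: ler_wpM2l; first exact: ltW.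
apply: ler_wpM2r; first exact: le_trans (weight_ge1 _).
rewrite -hn mulrA expRM_natr; apply: lerXn2r.
- by rewrite nnegrE addr_ge0// mulr_ge0// ltW.
- by rewrite nnegrE expR_ge0.
- exact: expR_ge1Dx.
Qed.

End MaximumPrinciple.

(** * Expectations along a Markov chain *)

Section CountableSums.
Context (R : realType) (S : countType).
Local Open Scope ereal_scope.
Implicit Types a b : S -> \bar R.

(** Extension by 0 to integers that code no element, so that sums over a countable type become
    series and monotone convergence applies. *)
Definition unpickled a (n : nat) : \bar R := oapp a 0 (pickle_inv n).

Lemma unpickled_ge0 a n : (forall y, 0 <= a y) -> 0 <= unpickled a n.
Proof. by move=> a0; rewrite /unpickled; case: pickle_inv => /=. Qed.

Lemma esum_series a : (forall y, 0 <= a y) ->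
  \esum_(y in [set: S]) a y = \sum_(n <oo) unpickled a n.
Proof.
move=> a0; rewrite nneseries_esumT; last by move=> n; exact: unpickled_ge0.
transitivity (\esum_(n in pickle @` [set: S]) unpickled a n).
  rewrite (esum_image _ pickle); last by move=> x y _ _; exact: (pcan_inj pickleK).
  by apply: eq_esum => y _; rewrite /unpickled pickleK_inv.
rewrite esum_mkcond; apply: eq_esum => n _; case: ifPn => //.
rewrite /unpickled; case e : pickle_inv => [y|]//= /negP []; rewrite inE; exists y => //.
by have /= := @pickle_invK S n; rewrite e.
Qed.

Lemma esumZl (c : R) a : (0 <= c)%R -> (forall y, 0 <= a y) ->
  \esum_(y in [set: S]) (c%:E * a y) = c%:E * \esum_(y in [set: S]) a y.
Proof.
move=> c0 a0; rewrite !esum_series//; last by move=> y; rewrite mule_ge0.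
rewrite -nneseriesZl; last by move=> n _; exact: unpickled_ge0.
by apply: eq_eseriesr => n _; rewrite /unpickled; case: pickle_inv => //=; rewrite mule0.
Qed.

Lemma exchange_esum (f : S -> S -> \bar R) : (forall x y, 0 <= f x y) ->
  \esum_(x in [set: S]) \esum_(y in [set: S]) f x y
  = \esum_(y in [set: S]) \esum_(x in [set: S]) f x y.
Proof.
move=> f0; rewrite !esum_esum//.
rewrite (reindex_esum ([set: S] `*`` (fun=> setT)) _ (fun x => (x.2, x.1)))//.
split => //= [[x y] [x' y'] _ _ [-> ->]//|[x y] _]; by exists (y, x).
Qed.

Section Integral.
Context d (T : measurableType d) (mu : {measure set T -> \bar R}) (D : set T).
Hypothesis mD : measurable D.
Variable f : S -> T -> \bar R.
Hypotheses (mf : forall y, measurable_fun D (f y)) (f0 : forall y t, D t -> 0 <= f y t).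

Let mf_unpickled n : measurable_fun D (fun t => unpickled (f^~ t) n).
Proof.
rewrite /unpickled; case: (pickle_inv n) => [y|] /=; first exact: mf.
exact: measurable_cst.
Qed.

Lemma measurable_fun_esum :
  measurable_fun D (fun t => \esum_(y in [set: S]) f y t).
Proof.
have : measurable_fun D (fun t => \sum_(n <oo | n \in predT) unpickled (f^~ t) n).
  by apply: ge0_emeasurable_sum => // n t Dt _; apply: unpickled_ge0 => y; exact: f0.
apply: eq_measurable_fun => t /[!inE] Dt; rewrite esum_series// => y; exact: f0.
Qed.

Lemma integral_esum :
  \int[mu]_(t in D) (\esum_(y in [set: S]) f y t)
  = \esum_(y in [set: S]) \int[mu]_(t in D) f y t.
Proof.
rewrite esum_series; last by move=> y; apply: integral_ge0 => t Dt; exact: f0.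
transitivity (\int[mu]_(t in D) (\sum_(n <oo) unpickled (f^~ t) n)).
  apply: eq_integral => t /[!inE] Dt; rewrite esum_series// => y; exact: f0.
rewrite integral_nneseries//; last first.
  by move=> n t Dt; apply: unpickled_ge0 => y; exact: f0.
apply: eq_eseriesr => n _; rewrite /unpickled; case: pickle_inv => //=.
by rewrite integral0.
Qed.

End Integral.
End CountableSums.

(** * Integrals of bounded functions over compact intervals *)

Section IntervalIntegrals.
Context (R : realType).
Local Notation leb := (@lebesgue_measure R).
Implicit Types (u v M : R) (f g : R -> R).

Lemma integrable_itv u v M f : measurable_fun `[u, v] f ->
  (forall w, u <= w <= v -> `|f w| <= M) -> leb.-integrable `[u, v] (EFin \o f).
Proof.
move=> mf fM; apply: measurable_bounded_integrable => //.
  by rewrite /= lebesgue_measure_itv /=; case: ifP => // _; rewrite -EFinB ltry.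
exists M; split; first exact: num_real.
by move=> r Mr w /=; rewrite in_itv /= => /fM fw; exact: le_trans (ltW Mr).
Qed.

Lemma Rintegral_itv_cst u v c : u <= v -> \int[leb]_(w in `[u, v]) c = c * (v - u).
Proof.
move=> uv; rewrite Rintegral_cst//= lebesgue_measure_itv /= lte_fin.
by case: ltgtP uv => //= -> _; rewrite subrr.
Qed.

Lemma ge_Rintegral_itv u v M f : u <= v -> measurable_fun `[u, v] f ->
  (forall w, u <= w <= v -> `|f w| <= M) -> `|\int[leb]_(w in `[u, v]) f w| <= M * (v - u).
Proof.
move=> uv mf fM; have intf := integrable_itv mf fM.
apply: le_trans (le_normr_Rintegral _ intf) _ => //.
rewrite -Rintegral_itv_cst//; apply: le_Rintegral => //.
- apply: (@integrable_itv _ _ M); first exact: measurableT_comp.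
  by move=> w /fM; rewrite normr_id.
- by apply: (@integrable_itv _ _ `|M|).
Qed.

Lemma Rintegral_itv_dist u v M N c f g : u <= v ->
  measurable_fun `[u, v] f -> measurable_fun `[u, v] g ->
  (forall w, u <= w <= v -> `|f w| <= M) -> (forall w, u <= w <= v -> `|g w| <= N) ->
  (forall w, u <= w <= v -> `|f w - g w| <= c) ->
  `|\int[leb]_(w in `[u, v]) f w - \int[leb]_(w in `[u, v]) g w| <= c * (v - u).
Proof.
move=> uv mf mg fM gN fg; rewrite -RintegralB//; first last.
- exact: integrable_itv gN.
- exact: integrable_itv fM.
by apply: ge_Rintegral_itv => //; exact: measurable_funB.
Qed.

Lemma EFin_Rintegral_itv u v M f : measurable_fun `[u, v] f ->
  (forall w, u <= w <= v -> `|f w| <= M) ->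
  (\int[leb]_(w in `[u, v]) f w)%:E = (\int[leb]_(w in `[u, v]) (f w)%:E)%E.
Proof.
by move=> mf fM; rewrite fineK//; apply: integrable_fin_num => //; exact: integrable_itv fM.
Qed.

End IntervalIntegrals.

(** * Kolmogorov equation and short-time expansions for rates of finite support *)

Section Chain.
Context (R : realType) (S : countType) (q : R -> S -> S -> R) (p : R -> S -> R -> S -> R).
Context (nb : S -> seq S) (c : S -> R).
Local Notation leb := (@lebesgue_measure R).
Implicit Types (u v w t : R) (x y z : S).
Hypothesis p_tf : is_transition_function q p.
Hypothesis nb_uniq : forall x, uniq (nb x).
Hypothesis q_ge0 : forall w x z, 0 <= w -> 0 <= q w x z.
Hypothesis q_supp : forall w x z, 0 <= w -> z \notin nb x -> q w x z = 0.
Hypothesis q_le : forall w x, 0 <= w -> \sum_(z <- nb x) q w x z <= c x.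
Hypothesis q_meas : forall x z, measurable_fun `[0 : R, +oo[%classic (fun w => q w x z).

Lemma p_ge0 u x t y : 0 <= u -> u <= t -> 0 <= p u x t y.
Proof. by case: p_tf => + _ _ _ _; apply. Qed.

Lemma p_sum1 u x t : 0 <= u -> u <= t -> (\esum_(y in [set: S]) (p u x t y)%:E = 1)%E.
Proof. by case: p_tf => _ + _ _ _; apply. Qed.

Lemma chapman u x v t y : 0 <= u -> u <= v -> v <= t ->
  ((p u x t y)%:E = \esum_(z in [set: S]) (p u x v z * p v z t y)%:E)%E.
Proof. by case: p_tf => _ _ + _ _; apply. Qed.

Lemma p_meas u x t y : 0 <= u -> measurable_fun `[u, t] (fun w => p w x t y).
Proof.
move=> u0; case: p_tf => _ _ _ + _ => /(_ x t y); apply: measurable_funS => //.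
by move=> w /=; rewrite !in_itv /= => /andP[uw ->]; rewrite (le_trans u0).
Qed.

Lemma p_le1 u x t y : 0 <= u -> u <= t -> p u x t y <= 1.
Proof.
move=> u0 ut; rewrite -lee_fin -(p_sum1 x u0 ut).
apply: esum_ge; exists [set y] => //.
by rewrite fsbig_set1.
Qed.

Lemma c_ge0 x : 0 <= c x.
Proof.
by apply: le_trans (q_le x (lexx 0)); apply: sumr_ge0 => z _; exact: q_ge0.
Qed.

Lemma sum_rates w x (D : S -> R) : 0 <= w ->
  \sum_(z \in [set: S]) q w x z * D z = \sum_(z <- nb x) q w x z * D z.
Proof.
move=> w0; rewrite -(fsbig_widen [set` nb x] setT) -?fsbig_seq//.
by move=> z /= [_ /negP zx]; rewrite q_supp// mul0r.
Qed.

Lemma sum_rates_le w x (D : S -> R) M : 0 <= w -> 0 <= M ->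
  (forall z, z \in nb x -> `|D z| <= M) -> `|\sum_(z <- nb x) q w x z * D z| <= c x * M.
Proof.
move=> w0 M0 DM; apply: le_trans (ler_norm_sum _ _ _) _.
apply: (@le_trans _ _ (\sum_(z <- nb x) q w x z * M)); last first.
  by rewrite -mulr_suml; apply: ler_wpM2r => //; exact: q_le.
rewrite big_seq [leRHS]big_seq; apply: ler_sum => z zx.
by rewrite normrM ger0_norm ?q_ge0//; apply: ler_wpM2l; [exact: q_ge0|exact: DM].
Qed.

Lemma q_meas_itv u t x z : 0 <= u -> measurable_fun `[u, t] (fun w => q w x z).
Proof.
move=> u0; apply: measurable_funS (q_meas x z) => //.
by move=> w /=; rewrite !in_itv /= => /andP[uw _]; rewrite (le_trans u0).
Qed.

Lemma sum_rates_meas u t x (D : R -> S -> R) : 0 <= u ->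
  (forall z, measurable_fun `[u, t] (D^~ z)) ->
  measurable_fun `[u, t] (fun w => \sum_(z <- nb x) q w x z * D w z).
Proof.
move=> u0 mD; apply: measurable_sum => z.
by apply: measurable_funM; [exact: q_meas_itv|exact: mD].
Qed.

Lemma kolmogorov u x t y : 0 <= u -> u <= t ->
  p u x t y = (x == y)%:R +
    \int[leb]_(w in `[u, t]) \sum_(z <- nb x) q w x z * (p w z t y - p w x t y).
Proof.
move=> u0 ut; case: p_tf => _ _ _ _ /(_ u x t y u0 ut) ->; congr (_ + _).
apply: eq_Rintegral => w; rewrite inE /= in_itv /= => /andP[uw _].
by rewrite sum_rates// (le_trans u0).
Qed.

Lemma p_norm_le1 u x t y : 0 <= u -> u <= t -> `|p u x t y| <= 1.
Proof. by move=> u0 ut; rewrite ger0_norm ?p_ge0// p_le1. Qed.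

(** With the outflow moved to the left all terms are nonnegative, so the identity can be weighted by
    [f y] and summed over [y] before any finiteness is known. *)
Lemma kolmogorov_split u x t y : 0 <= u -> u <= t ->
  p u x t y + \int[leb]_(w in `[u, t]) (\sum_(z <- nb x) q w x z * p w x t y)
  = (x == y)%:R + \int[leb]_(w in `[u, t]) \sum_(z <- nb x) q w x z * p w z t y.
Proof.
move=> u0 ut; rewrite {1}(kolmogorov x y u0 ut) -addrA; congr (_ + _).
have bound (x' : S -> S) w : u <= w <= t -> `|\sum_(z <- nb x) q w x z * p w (x' z) t y| <= c x * 1.
  move=> /andP[uw wt]; have w0 := le_trans u0 uw.
  by apply: sum_rates_le => // z _; exact: p_norm_le1.
have meas (x' : S -> S) : measurable_fun `[u, t] (fun w => \sum_(z <- nb x) q w x z * p w (x' z) t y).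
  by apply: sum_rates_meas => // z; exact: p_meas.
apply/eqP; rewrite eq_sym -subr_eq; apply/eqP.
rewrite -RintegralB//; last 2 first.
- exact: integrable_itv (meas id) (bound id).
- exact: integrable_itv (meas (fun=> x)) (bound (fun=> x)).
apply: eq_Rintegral => w _; rewrite -sumrB; apply: eq_bigr => z _.
by rewrite mulrBr.
Qed.

Section Expectation.
Local Open Scope ereal_scope.

Definition pexp u x t (f : S -> R) : \bar R := \esum_(y in [set: S]) (p u x t y * f y)%:E.

Lemma pexp_ge0 u x t f : (0 <= u)%R -> (u <= t)%R -> (forall y, (0 <= f y)%R) ->
  0 <= pexp u x t f.
Proof.
by move=> u0 ut f0; apply: esum_ge0 => y _; rewrite lee_fin mulr_ge0// p_ge0.
Qed.

Lemma pexp_le u x t f g : (0 <= u)%R -> (u <= t)%R -> (forall y, (f y <= g y)%R) ->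
  pexp u x t f <= pexp u x t g.
Proof.
by move=> u0 ut fg; apply: le_esum => y _; rewrite lee_fin ler_wpM2l// p_ge0.
Qed.

Lemma pexp_cst u x t (r : R) : (0 <= u)%R -> (u <= t)%R -> (0 <= r)%R ->
  pexp u x t (fun=> r) = r%:E.
Proof.
move=> u0 ut r0; rewrite -[RHS]mule1 -(p_sum1 x u0 ut) -esumZl//; last first.
  by move=> y; rewrite lee_fin p_ge0.
by apply: eq_esum => y _; rewrite -EFinM mulrC.
Qed.

Lemma pexp_chapman u x v t f : (0 <= u)%R -> (u <= v)%R -> (v <= t)%R ->
  (forall y, (0 <= f y)%R) ->
  pexp u x t f = \esum_(z in [set: S]) ((p u x v z)%:E * pexp v z t f).
Proof.
move=> u0 uv vt f0; have v0 := le_trans u0 uv.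
transitivity (\esum_(y in [set: S]) \esum_(z in [set: S])
    ((p u x v z)%:E * (p v z t y * f y)%:E)); last first.
  rewrite exchange_esum; last first.
    by move=> y z; rewrite -EFinM lee_fin !mulr_ge0// p_ge0.
  apply: eq_esum => z _; rewrite esumZl ?p_ge0// => y.
  by rewrite lee_fin mulr_ge0// p_ge0.
apply: eq_esum => y _; rewrite EFinM (chapman x y u0 uv vt) muleC -esumZl//; last first.
  by move=> z; rewrite lee_fin mulr_ge0// p_ge0.
by apply: eq_esum => z _; rewrite -!EFinM; congr EFin; ring.
Qed.

Lemma pexp_refl t x f : (0 <= t)%R -> (forall y, (0 <= f y)%R) -> pexp t x t f = (f x)%:E.
Proof.
move=> t0 f0; rewrite -[RHS](@esum_set1 _ _ x (fun y => (f y)%:E)) ?lee_fin// esum_mkcond.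
(* At equal times the integral runs over a single point, so [p t x t] is the Dirac mass at [x]. *)
apply: eq_esum => y _; rewrite (kolmogorov x y t0 (lexx t)) set_itv1 Rintegral_set1 addr0.
rewrite eq_sym; case: ifPn => [/[!inE] ->|/negP yx]; first by rewrite eqxx mul1r.
by case: eqP => [yx'|_]; rewrite ?mul0r//; case: yx; rewrite inE.
Qed.

Lemma measurable_pexp u x t f : (0 <= u)%R -> (forall y, (0 <= f y)%R) ->
  measurable_fun `[u, t] (fun w => pexp w x t f).
Proof.
move=> u0 f0; apply: measurable_fun_esum => //.
- move=> y; apply/measurable_EFinP; apply: measurable_funM; first exact: p_meas.
  exact: measurable_cst.
- move=> y w; rewrite /= in_itv /= => /andP[uw wt].
  by rewrite lee_fin mulr_ge0// p_ge0// (le_trans u0).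
Qed.

(** Stated additively because the expectations may be infinite; Tonelli exchanges the sum over [y]
    with the time integral on each side. *)
Lemma pexp_kolmogorov u x t f : (0 <= u)%R -> (u <= t)%R -> (forall y, (0 <= f y)%R) ->
  pexp u x t f
  + \int[leb]_(w in `[u, t]) ((\sum_(z <- nb x) q w x z)%:E * pexp w x t f)
  = (f x)%:E
    + \int[leb]_(w in `[u, t]) (\sum_(z <- nb x) (q w x z)%:E * pexp w z t f).
Proof.
move=> u0 ut f0.
have bound (x' : S -> S) y w : (u <= w <= t)%R ->
    (`|\sum_(z <- nb x) q w x z * p w (x' z) t y| <= c x * 1)%R.
  move=> /andP[uw wt]; have w0 := le_trans u0 uw.
  by apply: sum_rates_le => // z _; exact: p_norm_le1.
have meas (x' : S -> S) y : measurable_fun `[u, t]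
    (fun w => \sum_(z <- nb x) q w x z * p w (x' z) t y)%R.
  by apply: sum_rates_meas => // z; exact: p_meas.
have meas_f (x' : S -> S) y : measurable_fun `[u, t]
    (fun w => ((\sum_(z <- nb x) q w x z * p w (x' z) t y) * f y)%:E).
  by apply/measurable_EFinP; apply: measurable_funM; [exact: meas|exact: measurable_cst].
have ge0 (x' : S -> S) y w : `[u, t]%classic w ->
    0 <= ((\sum_(z <- nb x) q w x z * p w (x' z) t y) * f y)%:E.
  rewrite /= in_itv /= => /andP[uw wt]; have w0 := le_trans u0 uw.
  by rewrite lee_fin mulr_ge0// sumr_ge0// => z _; rewrite mulr_ge0 ?q_ge0 ?p_ge0.
have key (x' : S -> S) :
    \int[leb]_(w in `[u, t]) (\sum_(z <- nb x) (q w x z)%:E * pexp w (x' z) t f)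
    = \esum_(y in [set: S])
        ((\int[leb]_(w in `[u, t]) \sum_(z <- nb x) q w x z * p w (x' z) t y) * f y)%:E.
  under eq_esum.
    move=> y _; rewrite -RintegralZr//; last exact: integrable_itv (meas x' y) (bound x' y).
    rewrite (@EFin_Rintegral_itv _ _ _ (c x * 1 * f y)%R); last 2 first.
    - by apply: measurable_funM; [exact: meas|exact: measurable_cst].
    - by move=> w uwt; rewrite normrM (ger0_norm (f0 y)) ler_wpM2r// bound.
    over.
  rewrite -integral_esum//; [|exact: meas_f|exact: ge0].
  apply: eq_integral => w; rewrite inE /= in_itv /= => /andP[uw wt].
  have w0 := le_trans u0 uw.
  transitivity (\esum_(y in [set: S]) \sum_(z <- nb x) ((q w x z)%:E * (p w (x' z) t y * f y)%:E)).
    rewrite esum_sum; last first.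
      by move=> y z _ _; rewrite -EFinM lee_fin !mulr_ge0 ?q_ge0 ?p_ge0.
    apply: eq_bigr => z _; rewrite esumZl ?q_ge0// => y.
    by rewrite lee_fin mulr_ge0// p_ge0.
  apply: eq_esum => y _; rewrite mulr_suml -sumEFin; apply: eq_bigr => z _.
  by rewrite -EFinM mulrA.
rewrite (key id).
have -> : \int[leb]_(w in `[u, t]) ((\sum_(z <- nb x) q w x z)%:E * pexp w x t f)
    = \int[leb]_(w in `[u, t]) (\sum_(z <- nb x) (q w x z)%:E * pexp w x t f).
  apply: eq_integral => w; rewrite inE /= in_itv /= => /andP[uw wt].
  have w0 := le_trans u0 uw.
  by rewrite -sumEFin ge0_sume_distrl// => z _; rewrite lee_fin q_ge0.
rewrite (key (fun=> x)) -(@pexp_refl t x f) ?(le_trans u0)//.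
have int_ge0 (x' : S -> S) y : (0 <= \int[leb]_(w in `[u, t]) \sum_(z <- nb x) q w x z * p w (x' z) t y)%R.
  apply: Rintegral_ge0 => w; rewrite /= in_itv /= => /andP[uw wt].
  have w0 := le_trans u0 uw.
  by apply: sumr_ge0 => z _; rewrite mulr_ge0 ?q_ge0 ?p_ge0.
have t0 := le_trans u0 ut.
rewrite -!esumD => [|y _|y _|y _|y _]; try by rewrite lee_fin mulr_ge0 ?p_ge0.
apply: eq_esum => y _; rewrite -!EFinD -!mulrDl; congr (_ * _)%:E.
rewrite (kolmogorov x y t0 (lexx t)) set_itv1 Rintegral_set1 addr0 -kolmogorov_split//.
Qed.

End Expectation.

Definition rexp u x t (f : S -> R) : R := fine (pexp u x t f).

(** A sum over neighbours rather than a maximum: any difference between [x] and a neighbour is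
    bounded by it. *)
Definition reach (M : S -> R) x : R := M x + \sum_(z <- nb x) M z.

Lemma reach_ge (M : S -> R) x z : (forall y, 0 <= M y) -> z \in nb x ->
  M z + M x <= reach M x.
Proof.
move=> M0 zx; rewrite /reach addrC lerD2l (bigD1_seq z)//= lerDl.
by apply: sumr_ge0 => y _.
Qed.

Lemma reach_ge0 (M : S -> R) x : (forall y, 0 <= M y) -> 0 <= reach M x.
Proof. by move=> M0; rewrite addr_ge0// sumr_ge0. Qed.

Section BoundedExpectation.
Variables (t : R) (f M : S -> R).
Hypothesis f_ge0 : forall y, 0 <= f y.
Hypothesis fM : forall w z, 0 <= w -> w <= t -> (pexp w z t f <= (M z)%:E)%E.

Lemma rexpK u x : 0 <= u -> u <= t -> (rexp u x t f)%:E = pexp u x t f.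
Proof.
move=> u0 ut; rewrite fineK// ge0_fin_numE ?pexp_ge0//.
by apply: le_lt_trans (fM x u0 ut) _; rewrite ltry.
Qed.

Lemma rexp_ge0 u x : 0 <= u -> u <= t -> 0 <= rexp u x t f.
Proof. by move=> u0 ut; rewrite fine_ge0// pexp_ge0. Qed.

Lemma rexp_le u x : 0 <= u -> u <= t -> rexp u x t f <= M x.
Proof. by move=> u0 ut; rewrite -lee_fin rexpK// fM. Qed.

Lemma rexp_meas u x : 0 <= u -> measurable_fun `[u, t] (fun w => rexp w x t f).
Proof.
move=> u0; apply/measurable_EFinP.
have := @measurable_pexp u x t f u0 f_ge0; apply: eq_measurable_fun => w.
by rewrite inE /= in_itv /= => /andP[uw wt]; rewrite rexpK// (le_trans u0).
Qed.

Hypothesis M_ge0 : forall y, 0 <= M y.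

Lemma rexp_dist u w x z : 0 <= u -> u <= w <= t -> z \in nb x ->
  `|rexp w z t f - rexp w x t f| <= reach M x.
Proof.
move=> u0 /andP[uw wt] zx; have w0 := le_trans u0 uw.
apply: le_trans (reach_ge M_ge0 zx); rewrite ler_norml.
have := rexp_ge0 x w0 wt; have := rexp_le x w0 wt.
have := rexp_ge0 z w0 wt; have := rexp_le z w0 wt.
by move=> *; apply/andP; split; lra.
Qed.

Lemma rexp_kolmogorov u x : 0 <= u -> u <= t ->
  rexp u x t f = f x
    + \int[leb]_(w in `[u, t]) \sum_(z <- nb x) q w x z * (rexp w z t f - rexp w x t f).
Proof.
move=> u0 ut.
have meas (x' : S -> S) : measurable_fun `[u, t]
    (fun w => \sum_(z <- nb x) q w x z * rexp w (x' z) t f).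
  by apply: sum_rates_meas => // z; exact: rexp_meas.
have bound (x' : S -> S) w : u <= w <= t ->
    `|\sum_(z <- nb x) q w x z * rexp w (x' z) t f|
    <= c x * \sum_(z <- nb x) M (x' z).
  move=> /andP[uw wt]; have w0 := le_trans u0 uw.
  apply: sum_rates_le => //; first by apply: sumr_ge0.
  move=> z zx; rewrite ger0_norm ?rexp_ge0//; apply: le_trans (rexp_le _ w0 wt) _.
  by rewrite (bigD1_seq z)//= lerDl; apply: sumr_ge0.
have key (x' : S -> S) : (\int[leb]_(w in `[u, t])
      (\sum_(z <- nb x) (q w x z)%:E * pexp w (x' z) t f)
    = (\int[leb]_(w in `[u, t]) \sum_(z <- nb x) q w x z * rexp w (x' z) t f)%:E)%E.
  rewrite (EFin_Rintegral_itv (meas x') (bound x')); apply: eq_integral => w.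
  rewrite inE /= in_itv /= => /andP[uw wt]; have w0 := le_trans u0 uw.
  by rewrite -sumEFin; apply: eq_bigr => z _; rewrite EFinM rexpK.
have := pexp_kolmogorov x u0 ut f_ge0.
have -> : (\int[leb]_(w in `[u, t]) ((\sum_(z <- nb x) q w x z)%:E * pexp w x t f)
    = \int[leb]_(w in `[u, t]) (\sum_(z <- nb x) (q w x z)%:E * pexp w x t f))%E.
  apply: eq_integral => w; rewrite inE /= in_itv /= => /andP[uw wt].
  have w0 := le_trans u0 uw.
  by rewrite -sumEFin ge0_sume_distrl// => z _; rewrite lee_fin q_ge0.
rewrite (key id) (key (fun=> x)) -rexpK// -!EFinD => -[e].
under eq_Rintegral.
  move=> w _; under eq_bigr do rewrite mulrBr; rewrite sumrB; over.
rewrite /= RintegralB//; last 2 first.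
- exact: integrable_itv (meas id) (bound id).
- exact: integrable_itv (meas (fun=> x)) (bound (fun=> x)).
by rewrite addrA -e addrK.
Qed.

Definition first_order x : R := c x * reach M x.

Lemma first_order_ge0 x : 0 <= first_order x.
Proof. by rewrite mulr_ge0 ?c_ge0 ?reach_ge0. Qed.

Lemma rexp_first_order u x : 0 <= u -> u <= t ->
  `|rexp u x t f - f x| <= first_order x * (t - u).
Proof.
move=> u0 ut; rewrite rexp_kolmogorov// addrAC subrr add0r.
apply: ge_Rintegral_itv => //.
  apply: sum_rates_meas => // z; apply: measurable_funB; exact: rexp_meas.
move=> w uwt; have w0 : 0 <= w by case/andP: uwt => uw _; exact: le_trans uw.
apply: sum_rates_le => //; first exact: reach_ge0.
by move=> z zx; exact: rexp_dist u0 uwt zx.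
Qed.

(** In the integral equation, replace the expectations by their terminal value [f]. At each
    neighbour this errs by [first_order] times the elapsed time, and integrating once more gives the
    square. *)
Lemma rexp_second_order u x : 0 <= u -> u <= t ->
  `|rexp u x t f - (f x + \int[leb]_(w in `[u, t]) \sum_(z <- nb x) q w x z * (f z - f x))|
  <= c x * reach first_order x * (t - u) ^+ 2.
Proof.
move=> u0 ut; rewrite rexp_kolmogorov// opprD addrACA subrr add0r.
have tu : 0 <= t - u by rewrite subr_ge0.
rewrite expr2 mulrA; apply: (@Rintegral_itv_dist _ _ _ (c x * reach M x)
  (c x * \sum_(z <- nb x) `|f z - f x|)) => //.
- by apply: sum_rates_meas => // z; apply: measurable_funB; exact: rexp_meas.
- by apply: sum_rates_meas => // z; exact: measurable_cst.
- move=> w uwt; have w0 : 0 <= w by case/andP: uwt => uw _; exact: le_trans uw.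
  apply: sum_rates_le => //; first exact: reach_ge0.
  by move=> z zx; exact: rexp_dist u0 uwt zx.
- move=> w uwt; have w0 : 0 <= w by case/andP: uwt => uw _; exact: le_trans uw.
  apply: sum_rates_le => //; first exact: sumr_ge0.
  by move=> z zx; rewrite (bigD1_seq z)//= lerDl; apply: sumr_ge0.
- move=> w /andP[uw wt]; have w0 := le_trans u0 uw.
  rewrite -sumrB -mulrA; under eq_bigr do rewrite -mulrBr.
  apply: sum_rates_le => //.
    by rewrite mulr_ge0// reach_ge0//; exact: first_order_ge0.
  move=> z zx.
  have tw : t - w <= t - u by rewrite lerD2l lerN2.
  have F y : `|rexp w y t f - f y| <= first_order y * (t - u).
    apply: le_trans (rexp_first_order y w0 wt) _.
    by apply: ler_wpM2l => //; exact: first_order_ge0.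
  apply: le_trans (ler_wpM2r tu (reach_ge first_order_ge0 zx)).
  rewrite mulrDl; apply: le_trans (lerD (F z) (F x)).
  apply: le_trans (ler_normB _ _); rewrite le_eqVlt; apply/orP; left; apply/eqP.
  by congr `|_|; ring.
Qed.

End BoundedExpectation.

(* Staying put has probability at least [1 - c y (t' - t)], so that
   [t |-> p u x t y + c y * t] is nondecreasing. *)
Lemma p_stay t t' y : 0 <= t -> t <= t' -> 1 - c y * (t' - t) <= p t y t' y.
Proof.
move=> t0 tt'; rewrite kolmogorov// eqxx lerD2l.
have : `|\int[leb]_(w in `[t, t']) \sum_(z <- nb y) q w y z * (p w z t' y - p w y t' y)|
       <= c y * 1 * (t' - t).
  apply: ge_Rintegral_itv => //.
    by apply: sum_rates_meas => // z; apply: measurable_funB; exact: p_meas.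
  move=> w /andP[tw wt]; have w0 := le_trans t0 tw.
  apply: sum_rates_le => // z _; rewrite ler_norml.
  have := p_ge0 z y w0 wt; have := p_ge0 y y w0 wt.
  have := p_le1 z y w0 wt; have := p_le1 y y w0 wt.
  by move=> *; apply/andP; split; lra.
by rewrite mulr1 ler_norml => /andP[].
Qed.

Lemma p_drift u x t t' y : 0 <= u -> u <= t -> t <= t' ->
  p u x t y + c y * t <= p u x t' y + c y * t'.
Proof.
move=> u0 ut tt'; have t0 := le_trans u0 ut.
have h : p u x t y * p t y t' y <= p u x t' y.
  rewrite -lee_fin (chapman x y u0 ut tt'); apply: esum_ge; exists [set y] => //.
  by rewrite fsbig_set1.
have := ler_wpM2l (p_ge0 x y u0 ut) (p_stay y t0 tt').
have : p u x t y * (c y * (t' - t)) <= c y * (t' - t).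
  by rewrite ler_piMl ?p_le1// mulr_ge0 ?c_ge0// subr_ge0.
by move: h; lra.
Qed.

(** A transition function is assumed measurable in its starting time only. In the final time it is a
    difference of two nondecreasing functions; [Num.max u v] extends them to the whole line. *)
Lemma p_meas_forward u x t y : 0 <= u -> measurable_fun `[u, t] (p u x ^~ y).
Proof.
move=> u0.
have : measurable_fun `[u, t]
    (fun v => p u x (Num.max u v) y + c y * Num.max u v - c y * Num.max u v).
  apply: measurable_funB.
    apply: nondecreasing_measurable => // v w vw; apply: p_drift => //.
      by rewrite le_max lexx.
    by rewrite ge_max !le_max lexx /= vw orbT.
  apply: nondecreasing_measurable => // v w vw; apply: ler_wpM2l; first exact: c_ge0.
  by rewrite ge_max !le_max lexx /= vw orbT.
apply: eq_measurable_fun => v; rewrite inE /= in_itv /= => /andP[uv _].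
by rewrite (max_idPr uv) addrK.
Qed.

(** * Finite-horizon value with running and terminal reward *)

Section Value.
Variables (T m : R) (rew : R -> S -> R) (f M : S -> R).
Hypothesis T_ge0 : 0 <= T.
Hypothesis f_ge0 : forall y, 0 <= f y.
Hypothesis fM : forall w z, 0 <= w -> w <= T -> (pexp w z T f <= (M z)%:E)%E.
Hypothesis M_ge0 : forall y, 0 <= M y.
Hypothesis rew_ge0 : forall t y, 0 <= t -> 0 <= rew t y.
Hypothesis rew_le : forall t y, 0 <= t -> rew t y <= m.
Hypothesis rew_meas : forall y, measurable_fun `[0 : R, +oo[%classic (rew^~ y).

Definition gain u x t : \bar R := pexp u x t (rew t).

Definition value u x : \bar R :=
  (\int[leb]_(t in `[u, T]) gain u x t + pexp u x T f)%E.

Definition rvalue u x : R := fine (value u x).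

(** The state is a witness: for empty [S] nothing forces [m] to be nonnegative. *)
Let m_ge0 : S -> 0 <= m.
Proof. by move=> y; apply: le_trans (rew_le y (lexx 0)); exact: rew_ge0. Qed.

Lemma gain_ge0 u x t : 0 <= u -> u <= t -> (0 <= gain u x t)%E.
Proof. by move=> u0 ut; apply: pexp_ge0 => // y; rewrite rew_ge0// (le_trans u0). Qed.

Lemma gain_le u x t : 0 <= u -> u <= t -> (gain u x t <= m%:E)%E.
Proof.
move=> u0 ut; rewrite -(pexp_cst x u0 ut (m_ge0 x)).
by apply: pexp_le => // y; rewrite rew_le// (le_trans u0).
Qed.

Lemma gainE u x t : 0 <= u -> u <= t -> gain u x t = (rexp u x t (rew t))%:E.
Proof.
move=> u0 ut; have t0 := le_trans u0 ut.
rewrite (rexpK (M := fun=> m))// => [y|w z w0 wt]; first exact: rew_ge0.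
by rewrite -(pexp_cst z w0 wt (m_ge0 z)); apply: pexp_le => // y; exact: rew_le.
Qed.

Lemma rew_meas_itv u t y : 0 <= u -> measurable_fun `[u, t] (rew^~ y).
Proof.
move=> u0; apply: measurable_funS (rew_meas y) => //.
by move=> w /=; rewrite !in_itv /= => /andP[uw _]; rewrite (le_trans u0).
Qed.

Lemma gain_meas u v x t : 0 <= u -> u <= v -> measurable_fun `[v, t] (gain u x).
Proof.
move=> u0 uv; apply: measurable_fun_esum => //.
- move=> y; apply/measurable_EFinP.
  have mp : measurable_fun `[v, t] (p u x ^~ y).
    apply: (measurable_funS _ _ (@p_meas_forward u x t y u0)) => //.
    by move=> w /=; rewrite !in_itv /= => /andP[vw ->]; rewrite (le_trans uv).
  by apply: measurable_funM => //; apply: rew_meas_itv; exact: le_trans uv.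
- move=> y w; rewrite /= in_itv /= => /andP[vw _]; have uw := le_trans uv vw.
  by rewrite lee_fin mulr_ge0 ?p_ge0 ?rew_ge0// (le_trans u0).
Qed.

Lemma value_ge0 u x : 0 <= u -> u <= T -> (0 <= value u x)%E.
Proof.
move=> u0 uT; rewrite adde_ge0 ?pexp_ge0//; apply: integral_ge0 => t.
by rewrite /= in_itv /= => /andP[ut _]; exact: gain_ge0.
Qed.

Definition value_bound x : R := m * T + M x.

Lemma value_bound_ge0 x : 0 <= value_bound x.
Proof. by rewrite addr_ge0// mulr_ge0// m_ge0. Qed.

Lemma value_le u x : 0 <= u -> u <= T -> (value u x <= (value_bound x)%:E)%E.
Proof.
move=> u0 uT; rewrite EFinD leeD ?fM//.
apply: (@le_trans _ _ (\int[leb]_(t in `[u, T]) m%:E)%E).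
  apply: ge0_le_integral => //.
  - by move=> t; rewrite /= in_itv /= => /andP[ut _]; exact: gain_ge0.
  - exact: gain_meas.
  - by move=> t; rewrite /= in_itv /= => /andP[ut _]; exact: gain_le.
rewrite integral_cst//= lebesgue_measure_itv /= lte_fin.
have m0 := m_ge0 x.
case: ltP => _; last by rewrite mule0 lee_fin mulr_ge0.
by rewrite -EFinB -EFinM lee_fin ler_wpM2l// gerBl.
Qed.

Lemma rvalueK u x : 0 <= u -> u <= T -> (rvalue u x)%:E = value u x.
Proof.
move=> u0 uT; rewrite fineK// ge0_fin_numE ?value_ge0//.
by apply: le_lt_trans (value_le x u0 uT) _; rewrite ltry.
Qed.

Lemma rvalue_ge0 u x : 0 <= u -> u <= T -> 0 <= rvalue u x.
Proof. by move=> u0 uT; rewrite fine_ge0// value_ge0. Qed.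

Lemma rvalue_le u x : 0 <= u -> u <= T -> rvalue u x <= value_bound x.
Proof. by move=> u0 uT; rewrite -lee_fin rvalueK// value_le. Qed.

Lemma rvalue_end x : rvalue T x = f x.
Proof. by rewrite /rvalue /value set_itv1 integral_set1 add0e pexp_refl. Qed.

(** Dynamic programming at the intermediate time [v], in extended reals: by nonnegativity, Tonelli
    and Chapman-Kolmogorov need no integrability. *)
Lemma value_chapman u v x : 0 <= u -> u <= v -> v <= T ->
  (value u x = \int[leb]_(t in `[u, v]) gain u x t
    + \esum_(z in [set: S]) ((p u x v z)%:E * value v z))%E.
Proof.
move=> u0 uv vT; have v0 := le_trans u0 uv; have uT := le_trans uv vT.
have v_T t : `[v, T]%classic t -> v <= t by rewrite /= in_itv /= => /andP[].
rewrite /value (pexp_chapman x u0 uv vT f_ge0).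
have -> : (\int[leb]_(t in `[u, T]) gain u x t = \int[leb]_(t in `[u, v]) gain u x t
    + \int[leb]_(t in `[v, T]) gain u x t)%E.
  have uvT : `[u, T]%classic = `[u, v[%classic `|` `[v, T]%classic.
    by rewrite -itv_bndbnd_setU// ?bnd_simp.
  rewrite uvT ge0_integral_setU//=.
  - congr (_ + _)%E; rewrite integral_itv_bndo_bndc//.
    apply: measurable_funS (gain_meas (t := v) x u0 (lexx u)) => //.
    by move=> w /=; rewrite !in_itv /= => /andP[-> /ltW ->].
  - by rewrite -uvT; exact: gain_meas.
  - move=> t [] /=; rewrite in_itv /= => /andP[wt _]; apply: gain_ge0 => //.
    exact: le_trans wt.
  - rewrite disj_set2E; apply/eqP/seteqP; split => // t /= [].
    by rewrite !in_itv /= => /andP[_ tv] /andP[vt _]; move: vt; rewrite leNgt tv.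
rewrite -addeA; congr (_ + _)%E.
under [RHS]eq_esum => z _.
  rewrite muleDr//; last by rewrite ge0_adde_def// inE ?pexp_ge0// integral_ge0//
    => t /v_T vt; exact: gain_ge0.
  over.
rewrite esumD; last 2 first.
- move=> z _; rewrite mule_ge0 ?lee_fin ?p_ge0// integral_ge0// => t /v_T vt.
  exact: gain_ge0.
- by move=> z _; rewrite mule_ge0 ?lee_fin ?p_ge0// pexp_ge0.
congr (_ + _)%E; under eq_esum => z _.
  rewrite -ge0_integralZl//; last 3 first.
  - exact: gain_meas.
  - by move=> t /v_T vt; exact: gain_ge0.
  - by rewrite lee_fin p_ge0.
  over.
rewrite -integral_esum//; last 2 first.
- by move=> z; apply: measurable_funeM; exact: gain_meas.
- by move=> z t /v_T vt; rewrite mule_ge0 ?lee_fin ?p_ge0// gain_ge0.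
apply: eq_integral => t; rewrite inE => /v_T vt.
by apply: pexp_chapman => // y; rewrite rew_ge0// (le_trans v0).
Qed.

Lemma pexp_rvalue w v z : 0 <= w -> w <= v -> v <= T ->
  (\esum_(y in [set: S]) ((p w z v y)%:E * value v y) = pexp w z v (rvalue v))%E.
Proof.
move=> w0 wv vT; apply: eq_esum => y _.
by rewrite EFinM rvalueK// (le_trans w0).
Qed.

Lemma rvalue_chapman u v x : 0 <= u -> u <= v -> v <= T ->
  rvalue u x = \int[leb]_(t in `[u, v]) rexp u x t (rew t) + rexp u x v (rvalue v).
Proof.
move=> u0 uv vT; have v0 := le_trans u0 uv; have uT := le_trans uv vT.
have := value_chapman x u0 uv vT; rewrite pexp_rvalue// -rvalueK//.
rewrite -(@rexpK v (rvalue v) value_bound) ?rvalue_ge0//; last 2 first.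
- by move=> y; exact: rvalue_ge0.
(* The value at [v] seen from [w] is at most the value at [w], the reward on [[w, v]] being
   nonnegative; so the same bound serves for all [w]. *)
- move=> w z w0 wv; apply: le_trans (value_le z w0 (le_trans wv vT)).
  rewrite (value_chapman z w0 wv vT) pexp_rvalue// leeDr//; apply: integral_ge0 => t.
  by rewrite /= in_itv /= => /andP[wt _]; exact: gain_ge0.
rewrite (_ : \int[leb]_(t in `[u, v]) gain u x t
  = (\int[leb]_(t in `[u, v]) rexp u x t (rew t))%:E)%E; last first.
  rewrite (@EFin_Rintegral_itv _ _ _ m).
  - by apply: eq_integral => t; rewrite inE /= in_itv /= => /andP[ut _]; exact: gainE.
  - apply/measurable_EFinP; have := @gain_meas u u x v u0 (lexx u).
    apply: eq_measurable_fun => t; rewrite inE /= in_itv /= => /andP[ut _].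
    exact: gainE.
  - move=> t /andP[ut _]; rewrite ger0_norm -lee_fin -gainE//; first exact: gain_le.
    exact: gain_ge0.
by rewrite -EFinD => -[].
Qed.

Definition second_order x : R :=
  first_order (fun=> m) x + c x * reach (first_order value_bound) x.

(** The substitute for the backward differential equation: rates and rewards are only measurable in
    time, so they stay under the integral, and only the value is frozen at [v]. *)
Lemma value_backward u v x : 0 <= u -> u <= v -> v <= T ->
  `|rvalue u x - (rvalue v x + \int[leb]_(t in `[u, v])
      (rew t x + \sum_(z <- nb x) q t x z * (rvalue v z - rvalue v x)))|
  <= second_order x * (v - u) ^+ 2.
Proof.
move=> u0 uv vT; have v0 := le_trans u0 uv; have uT := le_trans uv vT.
have m0 := m_ge0 x; have vu : 0 <= v - u by rewrite subr_ge0.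
have rv0 y : 0 <= rvalue v y by exact: rvalue_ge0.
have rew_norm t : u <= t <= v -> `|rew t x| <= m.
  by move=> /andP[ut _]; rewrite ger0_norm ?rew_ge0 ?rew_le// (le_trans u0).
have jumps_meas : measurable_fun `[u, v]
    (fun t => \sum_(z <- nb x) q t x z * (rvalue v z - rvalue v x)).
  by apply: sum_rates_meas => // z; exact: measurable_cst.
have jumps_norm t : u <= t <= v ->
    `|\sum_(z <- nb x) q t x z * (rvalue v z - rvalue v x)|
    <= c x * \sum_(z <- nb x) `|rvalue v z - rvalue v x|.
  move=> /andP[ut _]; apply: sum_rates_le; [exact: le_trans ut|exact: sumr_ge0|].
  by move=> z zx; rewrite (bigD1_seq z)//= lerDl; apply: sumr_ge0.
rewrite RintegralD//; last 2 first.
- by apply: (integrable_itv _ rew_norm); exact: rew_meas_itv.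
- exact: integrable_itv jumps_meas jumps_norm.
have h2 : `|rexp u x v (rvalue v) - (rvalue v x + \int[leb]_(w in `[u, v])
    \sum_(z <- nb x) q w x z * (rvalue v z - rvalue v x))|
    <= c x * reach (first_order value_bound) x * (v - u) ^+ 2.
  apply: rexp_second_order => //; last exact: value_bound_ge0.
  move=> w z w0 wv; apply: le_trans (value_le z w0 (le_trans wv vT)).
  rewrite (value_chapman z w0 wv vT) pexp_rvalue// leeDr//; apply: integral_ge0 => t.
  by rewrite /= in_itv /= => /andP[wt _]; exact: gain_ge0.
have bnd t w z : 0 <= t -> 0 <= w -> w <= t -> (pexp w z t (rew t) <= m%:E)%E.
  move=> t0 w0 wt; rewrite -(pexp_cst z w0 wt m0); apply: pexp_le => // y; exact: rew_le.
have h1 : `|\int[leb]_(t in `[u, v]) rexp u x t (rew t) - \int[leb]_(t in `[u, v]) rew t x|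
    <= first_order (fun=> m) x * (v - u) * (v - u).
  apply: (@Rintegral_itv_dist _ _ _ m m) => //.
  - apply/measurable_EFinP; have := @gain_meas u u x v u0 (lexx u).
    apply: eq_measurable_fun => t; rewrite inE /= in_itv /= => /andP[ut _].
    exact: gainE.
  - exact: rew_meas_itv.
  - move=> t /andP[ut _]; rewrite ger0_norm -lee_fin -gainE//; first exact: gain_le.
    exact: gain_ge0.
  - move=> t /andP[ut tv]; have t0 := le_trans u0 ut.
    apply: (@le_trans _ _ (first_order (fun=> m) x * (t - u))).
      by apply: rexp_first_order => // [y|w z w0 wt]; [exact: rew_ge0|exact: bnd].
    by apply: ler_wpM2l; [apply: first_order_ge0|rewrite lerD2r].
rewrite (rvalue_chapman x u0 uv vT) /second_order mulrDl {1}expr2 mulrA.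
apply: le_trans (lerD h1 h2); apply: le_trans (ler_normD _ _).
by rewrite le_eqVlt; apply/orP; left; apply/eqP; congr `|_|; ring.
Qed.

End Value.
End Chain.

(** * Controlled chains *)

Section Rates.
Context (R : realType) (K : nat) (lambda theta mu : R).
Hypotheses (lambda_ge0 : 0 <= lambda) (theta_ge0 : 0 <= theta) (mu_ge0 : 0 <= mu).
Implicit Types (x y z : state K) (pi : policy R K).
Local Notation e := (unit_state K).
Local Notation "s :+ x" := (add_state s x) (at level 50, left associativity).
Local Notation "s :- x" := (sub_state s x) (at level 50, left associativity).

(** [undup] is needed: [serve x 1] and the departure of a one-phase customer are the same state, and
    [sum_indicator] wants each target once. *)
Definition neighbors x : seq (state K) :=
  undup (x :+ e K :: [seq serve x l.+1 | l : 'I_K] ++ [seq x :- e l.+1 | l : 'I_K]).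

Lemma neighbors_uniq x : uniq (neighbors x).
Proof. exact: undup_uniq. Qed.

Lemma arrival_neighbor x : x :+ e K \in neighbors x.
Proof. by rewrite mem_undup inE eqxx. Qed.

Lemma serve_neighbor x (l : 'I_K) : serve x l.+1 \in neighbors x.
Proof.
rewrite mem_undup inE mem_cat; apply/orP; right; apply/orP; left.
by apply/mapP; exists l; rewrite ?mem_enum.
Qed.

Lemma departure_neighbor x (l : 'I_K) : x :- e l.+1 \in neighbors x.
Proof.
rewrite mem_undup inE mem_cat; apply/orP; right; apply/orP; right.
by apply/mapP; exists l; rewrite ?mem_enum.
Qed.

Lemma sum_indicator (T : eqType) (r : seq T) (z0 : T) (D : T -> R) :
  uniq r -> z0 \in r -> \sum_(z <- r) (z == z0)%:R * D z = D z0.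
Proof.
move=> ur z0r; rewrite (bigD1_seq z0)//= eqxx mul1r big1 ?addr0// => z /negPf ->.
by rewrite mul0r.
Qed.

(** Charges a service to every occupied phase, so that it bounds the outflow under all actions at
    once. *)
Definition total_rate x : R :=
  lambda + \sum_(l < K | (0 < x l)%N) (mu + (x l)%:R * theta).

Lemma rate_ge0 (a : action K) x z : 0 <= rate lambda theta mu a x z.
Proof.
rewrite addr_ge0// ?mulr_ge0//; apply: sumr_ge0 => l _.
by rewrite addr_ge0// !mulr_ge0.
Qed.

Lemma rate_sum (a : action K) x (D : state K -> R) :
  \sum_(z <- neighbors x) rate lambda theta mu a x z * D z
  = lambda * D (x :+ e K) + \sum_(l < K | (0 < x l)%N)
      (mu * (a == l.+1 :> nat)%:R * D (serve x l.+1)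
       + (x l)%:R * theta * D (x :- e l.+1)).
Proof.
under eq_bigr do rewrite mulrDl mulr_suml; rewrite big_split /=; congr (_ + _).
  under eq_bigr do rewrite -mulrA; rewrite -mulr_sumr; congr (_ * _).
  by rewrite sum_indicator ?neighbors_uniq ?arrival_neighbor.
rewrite exchange_big /=; apply: eq_bigr => l _.
under eq_bigr do rewrite mulrDl -!mulrA; rewrite big_split /= -!mulr_sumr.
rewrite !sum_indicator ?neighbors_uniq ?departure_neighbor//; last exact: serve_neighbor.
by rewrite !mulrA.
Qed.

Lemma rate_sum_le (a : action K) x :
  \sum_(z <- neighbors x) rate lambda theta mu a x z <= total_rate x.
Proof.
have -> : \sum_(z <- neighbors x) rate lambda theta mu a x z
        = \sum_(z <- neighbors x) rate lambda theta mu a x z * (fun=> 1) z.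
  by under [RHS]eq_bigr do rewrite mulr1.
rewrite rate_sum /= mulr1 lerD2l; apply: ler_sum => l _; rewrite !mulr1 lerD2r.
by rewrite ler_piMr// lern1 leq_b1.
Qed.

Lemma rate_supp (a : action K) x z : z \notin neighbors x -> rate lambda theta mu a x z = 0.
Proof.
move=> zx; rewrite /rate; case: eqP => [zE|_].
  by move: zx; rewrite zE arrival_neighbor.
rewrite mulr0 add0r big1// => l _.
have z1 : (z == serve x l.+1) = false.
  by apply: contraNF zx => /eqP ->; exact: serve_neighbor.
have z2 : (z == x :- e l.+1) = false.
  by apply: contraNF zx => /eqP ->; exact: departure_neighbor.
by rewrite -[(x :- e l.+1) :+ e l]/(serve x l.+1) z1 z2 !mulr0 addr0.
Qed.

(* The generator of the chain under action [a], without costs. *)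
Definition action_gen (a : action K) (h : state K -> R) x : R :=
  background lambda theta h x + mu * (h (serve x a) - h x).

Lemma rate_gen (a : action K) x (h : state K -> R) : a \in feasible x ->
  \sum_(z <- neighbors x) rate lambda theta mu a x z * (h z - h x) = action_gen a h x.
Proof.
move=> fa; rewrite (rate_sum a x (fun z => h z - h x)) /action_gen /background.
rewrite -addrA; congr (_ + _); rewrite big_split /= addrC; congr (_ + _).
  rewrite mulr_sumr big_mkcond; apply: eq_bigr => l _.
  have [->|xl] := posnP (x l); first by rewrite mul0r mulr0.
  by rewrite mulrA [theta * _]mulrC.
case: (feasibleP fa) => [->|[l -> xl]].
  have -> : mu * (h (serve x 0) - h x) = 0 by rewrite serve0 subrr mulr0.
  apply: big1 => l _.
  by rewrite mulr0 mul0r.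
rewrite (bigD1 l)//= eqxx mulr1 big1 ?addr0// => i /andP[_ il].
case: eqP => [/succn_inj/val_inj li|_]; last by rewrite mulr0 mul0r.
by case/eqP: il.
Qed.

Lemma policy_rate_ge0 pi w x z : 0 <= w -> 0 <= policy_rate lambda theta mu pi w x z.
Proof. by move=> w0; apply: sumr_ge0 => a _; rewrite mulr_ge0 ?rate_ge0 ?rho_ge0. Qed.

Lemma policy_rate_supp pi w x z : 0 <= w -> z \notin neighbors x ->
  policy_rate lambda theta mu pi w x z = 0.
Proof. by move=> _ zx; rewrite /policy_rate big1// => a _; rewrite rate_supp// mul0r. Qed.

Lemma policy_rate_sum_le pi w x : 0 <= w ->
  \sum_(z <- neighbors x) policy_rate lambda theta mu pi w x z <= total_rate x.
Proof.
move=> w0; rewrite exchange_big /= -[leRHS]mulr1 -(rho_sum1 pi x w0) mulr_sumr.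
apply: ler_sum => a _; rewrite -mulr_suml; apply: ler_wpM2r; first exact: rho_ge0.
exact: rate_sum_le.
Qed.

Lemma policy_rate_meas pi x z :
  measurable_fun `[0 : R, +oo[%classic (fun w => policy_rate lambda theta mu pi w x z).
Proof.
rewrite (_ : (fun _ => _) = (fun w => \sum_(a : action K)
    if a \in feasible x then rate lambda theta mu a x z * pi w x a else 0)); last first.
  by apply/funext => w; rewrite -big_mkcond.
apply: measurable_sum => a; case: (a \in feasible x); last exact: measurable_cst.
apply: measurable_funM; [exact: measurable_cst|exact: rho_measurable].
Qed.

Lemma policy_rate_gen pi w x (h : state K -> R) : 0 <= w ->
  \sum_(z <- neighbors x) policy_rate lambda theta mu pi w x z * (h z - h x)
  = \sum_(a in feasible x) pi w x a * action_gen a h x.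
Proof.
move=> w0; under eq_bigr do rewrite mulr_suml; rewrite exchange_big /=.
apply: eq_bigr => a fa; rewrite -rate_gen// mulr_sumr; apply: eq_bigr => z _.
by rewrite mulrAC mulrC.
Qed.

Lemma policy_reward_ge0 pi t x : 0 <= t -> 0 <= policy_reward mu pi t x.
Proof. by move=> t0; apply: sumr_ge0 => a _; rewrite !mulr_ge0 ?rho_ge0. Qed.

Lemma policy_reward_le pi t x : 0 <= t -> policy_reward mu pi t x <= mu.
Proof.
move=> t0; rewrite -[leRHS]mulr1 -(rho_sum1 pi x t0) mulr_sumr; apply: ler_sum => a _.
by apply: ler_wpM2r; [exact: rho_ge0|rewrite ler_piMr// lern1 leq_b1].
Qed.

Lemma policy_reward_meas pi x :
  measurable_fun `[0 : R, +oo[%classic (fun t => policy_reward mu pi t x).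
Proof.
rewrite (_ : (fun _ => _) = (fun w => \sum_(a : action K)
    if a \in feasible x then reward mu x a * pi w x a else 0)); last first.
  by apply/funext => w; rewrite -big_mkcond.
apply: measurable_sum => a; case: (a \in feasible x); last exact: measurable_cst.
apply: measurable_funM; [exact: measurable_cst|exact: rho_measurable].
Qed.

Definition customersR x : R := (customers x)%:R.

Lemma background_customers x : (0 < K)%N ->
  background lambda theta customersR x = lambda - theta * customersR x.
Proof.
move=> K0; have dep (l : 'I_K) : (x l)%:R * (customersR (x :- e l.+1) - customersR x) = - (x l)%:R.
  have [->|xl] := posnP (x l); first by rewrite mul0r oppr0.
  rewrite /customersR customers_sub// -[in X in _ - X](prednK (customers_gt0 xl)).
  by rewrite -natr1 opprD addrA subrr add0r mulrN1.
rewrite /background; under eq_bigr do rewrite dep.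
rewrite /customersR customers_add customers_unit K0 leqnn /=.
rewrite natrD addrAC subrr add0r mulr1 -mulrN; congr (_ + _ * _).
by rewrite sumrN /customers natr_sum.
Qed.

Lemma customers_serve_feasible (a : action K) x : a \in feasible x ->
  customersR (serve x a) = customersR x - (a == 1%N :> nat)%:R.
Proof.
move=> fa; rewrite /customersR; case: (feasibleP fa) => [->|[l -> xl]].
  by rewrite serve0 subr0.
rewrite customers_serve// natrB; first by rewrite eqSS.
by have := customers_gt0 xl; case: (l == 0%N :> nat).
Qed.

(** Trades completions for abandonments: subtracting the value from [customersR] cancels the reward
    and leaves a running cost independent of the action. *)
Lemma action_gen_customers (a : action K) x : (0 < K)%N -> a \in feasible x ->
  action_gen a customersR x = lambda - theta * customersR x - reward mu x a.
Proof.
move=> K0 fa; rewrite /action_gen background_customers// customers_serve_feasible//.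
by rewrite /reward; ring.
Qed.

End Rates.

Section Levels.
Context (R : realType) (K : nat) (lambda theta mu : R).
Hypotheses (lambda_ge0 : 0 <= lambda) (theta_ge0 : 0 <= theta) (mu_ge0 : 0 <= mu).
Implicit Types (x y z : state K) (h : state K -> R).
Local Notation e := (unit_state K).
Local Notation "s :+ x" := (add_state s x) (at level 50, left associativity).
Local Notation "s :- x" := (sub_state s x) (at level 50, left associativity).

(** Only finitely many states have at most [n] customers, so constants depending on the state can be
    made uniform on a level. *)
Lemma level_bound (b : state K -> R) n :
  exists2 C : R, 0 <= C & forall x, (customers x <= n)%N -> b x <= C.
Proof.
pose st (g : {ffun 'I_K -> 'I_n.+1}) : state K := [ffun i => val (g i)].
exists (\sum_g `|b (st g)|); first exact: sumr_ge0.
move=> x xn; have xln l : (x l < n.+1)%N.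
  by rewrite ltnS (leq_trans _ xn)// /customers (bigD1 l)//= leq_addr.
have -> : x = st [ffun l => Ordinal (xln l)] by apply/ffunP => l; rewrite !ffunE.
set g := [ffun _ => _]; rewrite (bigD1 g)//=; apply: le_trans (ler_norm _) _.
by rewrite lerDl; exact: sumr_ge0.
Qed.

Lemma background_norm h x (D : R) : (forall y, (customers y <= (customers x).+1)%N -> `|h y| <= D) ->
  `|background lambda theta h x| <= (lambda + theta * (customers x)%:R) * (D *+ 2).
Proof.
move=> hD; have hx := hD x (leqnSn _).
have dist y : (customers y <= (customers x).+1)%N -> `|h y - h x| <= D *+ 2.
  by move=> /hD hy; apply: le_trans (ler_normB _ _) _; rewrite mulr2n lerD.
rewrite mulrDl; apply: le_trans (ler_normD _ _) _; apply: lerD.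
  rewrite normrM ger0_norm//; apply: ler_wpM2l => //; apply: dist.
  exact: customers_unit_le.
rewrite normrM ger0_norm// -mulrA; apply: ler_wpM2l => //.
apply: le_trans (ler_norm_sum _ _ _) _; rewrite /customers natr_sum mulr_suml.
apply: ler_sum => l _; rewrite normrM ger0_norm//.
have [->|xl] := posnP (x l); first by rewrite !mul0r.
by apply: ler_wpM2l => //; apply: dist; rewrite customers_sub//; exact: leq_trans (leq_pred _) _.
Qed.

Lemma action_gen_norm (a : action K) h x (D : R) : a \in feasible x ->
  (forall y, (customers y <= (customers x).+1)%N -> `|h y| <= D) ->
  `|action_gen lambda theta mu a h x|
  <= (lambda + theta * (customers x)%:R + mu) * (D *+ 2).
Proof.
move=> fa hD; rewrite mulrDl; apply: le_trans (ler_normD _ _) _.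
apply: lerD (background_norm hD) _; rewrite normrM ger0_norm//; apply: ler_wpM2l => //.
apply: le_trans (ler_normB _ _) _; rewrite mulr2n lerD ?hD//.
case: (feasibleP fa) => [->|[l -> xl]]; first by rewrite serve0.
by rewrite customers_serve// (leq_trans (leq_subr _ _)).
Qed.

Lemma ineq_lin_norm (k : ineq K) h (D : R) : 0 <= D ->
  (forall y, (customers y <= (customers (ineq_base k)).+2)%N -> `|h y| <= D) ->
  `|ineq_lin theta mu k h| <= (mu *+ 2 + theta *+ 2 + 2) * D.
Proof.
move=> D0.
have two (a b : R) : `|a| <= D -> `|b| <= D -> `|a - b| <= D *+ 2.
  by move=> aD bD; apply: le_trans (ler_normB _ _) _; rewrite mulr2n lerD.
have mD : 0 <= mu * D by rewrite mulr_ge0.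
have tD : 0 <= theta * D by rewrite mulr_ge0.
have four (a b c d : R) : `|a| <= D -> `|b| <= D -> `|c| <= D -> `|d| <= D ->
    `|mu * (a - b) - theta * (c - d)| <= (mu *+ 2 + theta *+ 2 + 2) * D.
  move=> aD bD cD dD; apply: le_trans (ler_normB _ _) _.
  rewrite !normrM (ger0_norm mu_ge0) (ger0_norm theta_ge0).
  have := ler_wpM2l mu_ge0 (two _ _ aD bD); have := ler_wpM2l theta_ge0 (two _ _ cD dD).
  move: mD tD; lra.
have S1 s i : (customers (s :+ e i) <= (customers s).+2)%N.
  by rewrite (leq_trans (customers_unit_le _ _)).
have S2 s i j : (customers (s :+ e i :+ e j) <= (customers s).+2)%N.
  by rewrite (leq_trans (customers_unit_le _ _))// ltnS customers_unit_le.
case: k => [j s|i s|i j s|i j s] /= hD.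
- have := two _ _ (hD s (leq_trans (leqnSn _) (leqnSn _))) (hD _ (S1 s j)).
  by move: mD tD; lra.
- by have := two _ _ (hD _ (S1 s i)) (hD _ (S1 s i.-1)); move: mD tD; lra.
- by apply: four; apply: hD.
- by apply: four; apply: hD.
Qed.

End Levels.

Section Averages.
Context (R : realType) (K : nat) (pi : policy R K).
Local Notation leb := (@lebesgue_measure R).
Implicit Types (t u v : R) (x : state K) (G : action K -> R).

Definition average t x G : R := \sum_(a in feasible x) pi t x a * G a.

Lemma average_ge t x G lo : 0 <= t -> (forall a, a \in feasible x -> lo <= G a) ->
  lo <= average t x G.
Proof.
move=> t0 lG; rewrite -[leLHS]mul1r -(rho_sum1 pi x t0) mulr_suml.
by apply: ler_sum => a fa; apply: ler_wpM2l; [exact: rho_ge0|exact: lG].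
Qed.

Lemma average_norm t x G D : 0 <= t -> (forall a, a \in feasible x -> `|G a| <= D) ->
  `|average t x G| <= D.
Proof.
move=> t0 GD; apply: le_trans (ler_norm_sum _ _ _) _.
rewrite -[leRHS]mul1r -(rho_sum1 pi x t0) mulr_suml.
by apply: ler_sum => a fa; rewrite normrM ger0_norm ?rho_ge0// ler_wpM2l ?rho_ge0// GD.
Qed.

Lemma average_meas u v x G : 0 <= u ->
  measurable_fun `[u, v] (fun t => average t x G).
Proof.
move=> u0; rewrite (_ : (fun _ => _) = (fun t => \sum_(a : action K)
    if a \in feasible x then pi t x a * G a else 0)); last first.
  by apply/funext => w; rewrite -big_mkcond.
apply: measurable_sum => a; case: (a \in feasible x); last exact: measurable_cst.
apply: measurable_funM; last exact: measurable_cst.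
apply: measurable_funS (rho_measurable pi x a) => //.
by move=> w /=; rewrite !in_itv /= => /andP[uw _]; rewrite (le_trans u0).
Qed.

Definition int_average u v x G : R := \int[leb]_(t in `[u, v]) average t x G.

Lemma average_bound t x G : 0 <= t -> `|average t x G| <= \sum_(a in feasible x) `|G a|.
Proof.
move=> t0; apply: average_norm => // a fa; rewrite (bigD1 a)//= lerDl.
by apply: sumr_ge0.
Qed.

Lemma int_average_ge u v x G lo : 0 <= u -> u <= v ->
  (forall a, a \in feasible x -> lo <= G a) -> lo * (v - u) <= int_average u v x G.
Proof.
move=> u0 uv lG; rewrite -Rintegral_itv_cst//; apply: le_Rintegral => //.
- by apply: (@integrable_itv _ _ _ `|lo|).
- apply: (integrable_itv (M := \sum_(a in feasible x) `|G a|)).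
    exact: average_meas.
  by move=> t /andP[ut _]; apply: average_bound; exact: le_trans ut.
- by move=> t; rewrite /= in_itv /= => /andP[ut _]; apply: average_ge => //; exact: le_trans ut.
Qed.

Lemma int_average_norm u v x G D : 0 <= u -> u <= v ->
  (forall a, a \in feasible x -> `|G a| <= D) -> `|int_average u v x G| <= D * (v - u).
Proof.
move=> u0 uv GD; apply: ge_Rintegral_itv => //; first exact: average_meas.
by move=> t /andP[ut _]; apply: average_norm => //; exact: le_trans ut.
Qed.

Lemma int_averageB u v x G1 G2 : 0 <= u -> u <= v ->
  int_average u v x G1 - int_average u v x G2
  = int_average u v x (fun a => G1 a - G2 a).
Proof.
move=> u0 uv; have int G : leb.-integrable `[u, v] (EFin \o (fun t => average t x G)).
  apply: (integrable_itv (M := \sum_(a in feasible x) `|G a|)).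
    exact: average_meas.
  by move=> t /andP[ut _]; apply: average_bound; exact: le_trans ut.
rewrite /int_average -RintegralB//; apply: eq_Rintegral => t _.
by rewrite /average -sumrB; apply: eq_bigr => a _; rewrite mulrBr.
Qed.

Lemma eq_int_average u v x G1 G2 : (forall a, a \in feasible x -> G1 a = G2 a) ->
  int_average u v x G1 = int_average u v x G2.
Proof.
by move=> e; apply: eq_Rintegral => t _; apply: eq_bigr => a fa; rewrite e.
Qed.

Lemma int_average_cst u v x r : 0 <= u -> u <= v ->
  int_average u v x (fun=> r) = r * (v - u).
Proof.
move=> u0 uv; rewrite -Rintegral_itv_cst//; apply: eq_Rintegral => t.
rewrite inE /= in_itv /= => /andP[ut _].
by rewrite /average -mulr_suml rho_sum1 ?mul1r// (le_trans u0).
Qed.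

End Averages.

Lemma int_average_srept (R : realType) (K : nat) (u v : R) (x : state K) G : u <= v ->
  int_average (srept R K) u v x G = G (srept_action x) * (v - u).
Proof.
move=> uv; rewrite -Rintegral_itv_cst//; apply: eq_Rintegral => t _.
rewrite /average (bigD1 (srept_action x)) ?srept_action_feasible//= big1.
  by rewrite /srept_rho eqxx mul1r addr0.
by move=> a /andP[_ /negPf ax]; rewrite /srept_rho ax mul0r.
Qed.

Section Drain.
Context (R : realType) (lambda theta : R).
Hypotheses (lambda_ge0 : 0 <= lambda) (theta_gt0 : 0 < theta).
Implicit Types (h n tau : R).

(* The mean at time [tau] of the number of customers when, from [n] customers
   on, abandonment is the only way out. *)
Definition drain tau n : R :=
  expR (- (theta * tau)) * n + lambda / theta * (1 - expR (- (theta * tau))).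

Lemma drain0 n : drain 0 n = n.
Proof. by rewrite /drain mulr0 oppr0 expR0 mul1r subrr mulr0 addr0. Qed.

Lemma expRN_le1 tau : 0 <= tau -> expR (- (theta * tau)) <= 1.
Proof. by move=> tau0; rewrite -expR0 ler_expR oppr_le0 mulr_ge0// ltW. Qed.

Lemma drain_le tau n : 0 <= tau -> 0 <= n -> drain tau n <= n + lambda / theta.
Proof.
move=> tau0 n0; have E0 := expR_ge0 (- (theta * tau)).
have a0 : 0 <= lambda / theta by rewrite divr_ge0// ltW.
by rewrite lerD// ?ler_piMl ?expRN_le1// ler_piMr// gerBl.
Qed.

(** The upper bound follows from [expR x >= 1 + x] and [(1 - x + x ^+ 2) * (1 + x) = 1 + x ^+ 3 >=
    1]. *)
Lemma expRN_bounds (x : R) : 0 <= x -> 1 - x <= expR (- x) <= 1 - x + x ^+ 2.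
Proof.
move=> x0; rewrite expR_ge1Dx /= expRN -[leLHS]mul1r ler_pdivrMr ?expR_gt0//.
have y0 : 0 <= 1 - x + x ^+ 2 by nra.
apply: le_trans (ler_wpM2l y0 (expR_ge1Dx x)).
have : 0 <= x ^+ 3 by rewrite exprn_ge0.
have -> : (1 - x + x ^+ 2) * (1 + x) = 1 + x ^+ 3 by ring.
by rewrite lerDl.
Qed.

(** In the coefficient of [n] the convexity bound on [expR] has the right sign; only the arrival
    part costs a quadratic error, which is therefore uniform in [n]. *)
Lemma drain_step tau h n : 0 <= tau -> 0 <= h -> 0 <= n ->
  h * (expR (- (theta * tau)) * (lambda - theta * n)) - lambda * theta * h ^+ 2
  <= drain (tau + h) n - drain tau n.
Proof.
move=> tau0 h0 n0; rewrite /drain [theta * (tau + h)]mulrDr [- (_ + theta * h)]opprD expRD.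
set E := expR (- (theta * tau)).
have E0 : 0 <= E by exact: expR_ge0.
have E1 : E <= 1 by exact: expRN_le1.
have x0 : 0 <= theta * h by rewrite mulr_ge0// ltW.
have /andP[] := expRN_bounds x0; set e := expR _ => e1 e2.
have a0 : 0 <= lambda / theta by rewrite divr_ge0// ltW.
have -> : lambda - theta * n = theta * (lambda / theta - n).
  by field; rewrite gt_eqF.
have -> : lambda * theta * h ^+ 2 = lambda / theta * (theta * h) ^+ 2.
  by field; rewrite gt_eqF.
set a := lambda / theta in a0 *; set x := theta * h in x0 e1 e2 *.
have h1 : E * (x * n) >= E * ((1 - e) * n).
  by apply: ler_wpM2l => //; apply: ler_wpM2r => //; move: e1; lra.
have h2 : E * ((1 - e) * a) >= E * ((x - x ^+ 2) * a).
  by apply: ler_wpM2l => //; apply: ler_wpM2r => //; move: e2; lra.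
have h3 : E * (x ^+ 2 * a) <= x ^+ 2 * a.
  by rewrite ler_piMl// mulr_ge0// sqr_ge0.
have -> : h * (E * (theta * (a - n))) = E * (x * a) - E * (x * n).
  by rewrite /x; ring.
by move: h1 h2 h3; lra.
Qed.

End Drain.

Section PolicyChain.
Context (R : realType) (K : nat) (lambda theta mu : R).
Hypotheses (K_gt0 : (0 < K)%N).
Hypotheses (lambda_ge0 : 0 <= lambda) (theta_gt0 : 0 < theta) (mu_ge0 : 0 <= mu).
Variables (pi : policy R K) (p : R -> state K -> R -> state K -> R).
Hypothesis p_tf : is_transition_function (policy_rate lambda theta mu pi) p.
Local Notation leb := (@lebesgue_measure R).
Implicit Types (u v t : R) (x y z : state K).

Let theta_ge0 : 0 <= theta. Proof. exact: ltW. Qed.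
Let nb_uniq := @neighbors_uniq K.
Let q_ge0 := policy_rate_ge0 lambda_ge0 theta_ge0 mu_ge0 pi.
Let q_supp := policy_rate_supp lambda theta mu pi.
Let q_le := policy_rate_sum_le lambda theta mu_ge0 pi.
Let q_meas := policy_rate_meas lambda theta mu pi.

Section Reward.
Variables (T : R) (rew : state K -> action K -> R) (m : R) (f M : state K -> R).
Hypothesis T_ge0 : 0 <= T.
Hypothesis rew_ge0 : forall x a, 0 <= rew x a.
Hypothesis rew_le : forall x a, rew x a <= m.
Hypothesis f_ge0 : forall y, 0 <= f y.
Hypothesis fM : forall w z, 0 <= w -> w <= T -> (pexp p w z T f <= (M z)%:E)%E.

Definition policy_value : R -> state K -> R :=
  rvalue p T (fun t x => average pi t x (rew x)) f.

Let avg_ge0 t x : 0 <= t -> 0 <= average pi t x (rew x).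
Proof. by move=> t0; apply: average_ge. Qed.

Let avg_le t x : 0 <= t -> average pi t x (rew x) <= m.
Proof.
move=> t0; apply: le_trans (ler_norm _) _; apply: average_norm => // a _.
by rewrite ger0_norm.
Qed.

Let avg_meas x : measurable_fun `[0 : R, +oo[%classic (fun t => average pi t x (rew x)).
Proof.
rewrite (_ : (fun _ => _) = (fun t => \sum_(a : action K)
    if a \in feasible x then pi t x a * rew x a else 0)); last first.
  by apply/funext => w; rewrite -big_mkcond.
apply: measurable_sum => a; case: (a \in feasible x); last exact: measurable_cst.
by apply: measurable_funM; [exact: rho_measurable|exact: measurable_cst].
Qed.

Lemma policy_value_ge0 u x : 0 <= u -> u <= T -> 0 <= policy_value u x.
Proof. exact: (rvalue_ge0 p_tf f_ge0 avg_ge0). Qed.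

Lemma policy_value_le u x : 0 <= u -> u <= T -> policy_value u x <= m * T + M x.
Proof.
exact: (rvalue_le p_tf nb_uniq q_ge0 q_supp q_le q_meas T_ge0 f_ge0 fM
  avg_ge0 avg_le avg_meas).
Qed.

Lemma policy_value_end x : policy_value T x = f x.
Proof. exact: (rvalue_end p_tf nb_uniq q_supp _ T_ge0 f_ge0). Qed.

Lemma policy_valueK u x : 0 <= u -> u <= T ->
  ((policy_value u x)%:E = \int[leb]_(t in `[u, T])
      pexp p u x t (fun y => average pi t y (rew y)) + pexp p u x T f)%E.
Proof.
exact: (rvalueK p_tf nb_uniq q_ge0 q_supp q_le q_meas T_ge0 f_ge0 fM
  avg_ge0 avg_le avg_meas).
Qed.

Lemma policy_value_backward (M_ge0 : forall y, 0 <= M y) n :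
  exists2 C : R, 0 <= C & forall u v x, (customers x <= n)%N -> 0 <= u -> u <= v -> v <= T ->
  `|policy_value u x - policy_value v x - int_average pi u v x
      (fun a => rew x a + action_gen lambda theta mu a (policy_value v) x)|
  <= C * (v - u) ^+ 2.
Proof.
have [C C0 hC] := level_bound (second_order (@neighbors K) (total_rate lambda theta mu) T m M) n.
exists C => // u v x xn u0 uv vT.
apply: le_trans (ler_wpM2r (sqr_ge0 _) (hC x xn)).
apply: le_trans (value_backward p_tf nb_uniq q_ge0 q_supp q_le q_meas T_ge0 f_ge0 fM
  M_ge0 avg_ge0 avg_le avg_meas x u0 uv vT).
rewrite le_eqVlt; apply/orP; left; apply/eqP; congr `|_|.
rewrite /policy_value opprD addrA; congr (_ - _); apply: eq_Rintegral => t.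
rewrite inE /= in_itv /= => /andP[ut _].
rewrite (policy_rate_gen lambda theta mu pi x (rvalue p T _ f v) (le_trans u0 ut)).
by rewrite /average -big_split /=; apply: eq_bigr => a _; rewrite mulrDr.
Qed.

End Reward.
End PolicyChain.

Section GeneratorBounds.
Context (R : realType) (K : nat) (lambda theta mu : R).
Hypotheses (lambda_ge0 : 0 <= lambda) (theta_ge0 : 0 <= theta) (mu_ge0 : 0 <= mu).
Implicit Types (x y : state K) (f g h : state K -> R).

Lemma action_genD (a : action K) (b1 b2 : R) f g x :
  action_gen lambda theta mu a (fun y => b1 * f y + b2 * g y) x
  = b1 * action_gen lambda theta mu a f x + b2 * action_gen lambda theta mu a g x.
Proof. by rewrite /action_gen backgroundD; ring. Qed.

Lemma action_genB (a : action K) f g x :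
  action_gen lambda theta mu a (fun y => f y - g y) x
  = action_gen lambda theta mu a f x - action_gen lambda theta mu a g x.
Proof.
rewrite [in LHS](_ : (fun y => f y - g y) = (fun y => 1 * f y + (- 1) * g y)).
  by rewrite action_genD mul1r mulN1r.
by apply/funext => y; rewrite mul1r mulN1r.
Qed.

Lemma action_gen_cst (a : action K) (r : R) x : action_gen lambda theta mu a (fun=> r) x = 0.
Proof. by rewrite /action_gen background_cst subrr mulr0 addr0. Qed.

(** Only arrivals reach a larger weight, at most 4 times the current one, whence [lambda *+ 3].
    Departures and services start within [eta] of the bound and cannot go below it, so the factor
    [N] multiplies [eta] alone. *)
Lemma action_gen_ge (a : action K) h x (b eta : R) N : a \in feasible x ->
  (customers x <= N)%N -> 0 <= b -> 0 <= eta ->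
  (forall y, - (b * weight R (customers y)) <= h y) ->
  h x <= - (b * weight R (customers x)) + eta ->
  - (lambda *+ 3 * (b * weight R (customers x)) + (lambda + theta * N%:R + mu) * eta)
  <= action_gen lambda theta mu a h x.
Proof.
move=> fa xN b0 eta0 hb hx; set n := customers x in hx xN *.
have bw k l : (k <= l)%N -> b * weight R k <= b * weight R l.
  move=> kl; apply: ler_wpM2l => //; rewrite /weight lerXn2r ?nnegrE//.
  by rewrite ler_nat.
have arr : - (b * weight R n.+1) <= h (add_state x (unit_state K K)).
  by apply: le_trans (hb _); rewrite lerN2 bw// customers_unit_le.
have dep (l : 'I_K) : (0 < x l)%N -> - (b * weight R n) <= h (sub_state x (unit_state K l.+1)).
  by move=> xl; apply: le_trans (hb _); rewrite lerN2 bw// customers_sub// leq_pred.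
have srv : - (b * weight R n) <= h (serve x a).
  apply: le_trans (hb _); rewrite lerN2 bw//.
  case: (feasibleP fa) => [->|[l -> xl]]; first by rewrite serve0.
  by rewrite customers_serve// leq_subr.
have w : b * weight R n.+1 <= b * weight R n *+ 4.
  rewrite -mulrnAr; apply: ler_wpM2l => //; rewrite /weight -[_ ^+ 2 *+ 4]mulr_natr -!natrX -natrM ler_nat.
  by rewrite -[4%N]/(2 ^ 2)%N -expnMn leq_exp2r//; nlia.
have h1 : - (lambda * (b * weight R n *+ 3) + lambda * eta)
    <= lambda * (- (b * weight R n.+1) - h x).
  rewrite -mulrDr -mulrN; apply: ler_wpM2l => //.
  by move: w hx; lra.
have h2 : - (theta * N%:R * eta) <= theta * n%:R * (- (b * weight R n) - h x).
  apply: (@le_trans _ _ (theta * n%:R * - eta)).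
    rewrite mulrN lerN2; apply: ler_wpM2r => //; apply: ler_wpM2l => //.
    by rewrite ler_nat.
  by apply: ler_wpM2l; [rewrite mulr_ge0|move: hx; lra].
have h3 : - (mu * eta) <= mu * (h (serve x a) - h x).
  by rewrite -mulrN; apply: ler_wpM2l => //; move: srv hx; lra.
have h4 := background_ge lambda_ge0 theta_ge0 arr dep.
by rewrite /action_gen; move: h1 h2 h3 h4; rewrite -/n; lra.
Qed.

End GeneratorBounds.

(** * Bound on the expected number of customers *)

Section Moment.
Context (R : realType) (K : nat) (lambda theta mu : R).
Hypotheses (K_gt0 : (0 < K)%N).
Hypotheses (lambda_ge0 : 0 <= lambda) (theta_gt0 : 0 < theta) (mu_ge0 : 0 <= mu).
Variables (pi : policy R K) (p : R -> state K -> R -> state K -> R).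
Hypothesis p_tf : is_transition_function (policy_rate lambda theta mu pi) p.
Implicit Types (u v t T : R) (x y z : state K).

Let theta_ge0 : 0 <= theta. Proof. exact: ltW. Qed.

(** The expansions require an a priori bound on the expected terminal reward, which for the number
    of customers is precisely the aim; truncation supplies one. *)
Definition truncated N x : R := (minn (customers x) N)%:R.

Lemma truncated_moment N T u x : 0 <= u -> u <= T ->
  (pexp p u x T (truncated N) <= (drain lambda theta (T - u) (customersR R x))%:E)%E.
Proof.
move=> u0 uT; have T0 := le_trans u0 uT.
(* With zero running reward the value is the expectation of [truncated N], so the one-step expansion
   is available for it. *)
pose V := policy_value pi p T (fun _ _ => 0) (truncated N).
have f_ge0 y : 0 <= truncated N y by exact: ler0n.
have fM w z : 0 <= w -> w <= T -> (pexp p w z T (truncated N) <= N%:R%:E)%E.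
  move=> w0 wT; rewrite -(pexp_cst p_tf z w0 wT (ler0n R N)).
  by apply: (pexp_le p_tf) => // y; rewrite ler_nat geq_minr.
have V_le w y : 0 <= w -> w <= T -> V w y <= N%:R.
  move=> w0 wT; have := policy_value_le lambda_ge0 theta_gt0 mu_ge0 p_tf T0
    (fun _ _ => lexx 0) (fun _ _ => lexx 0) f_ge0 fM y w0 wT.
  by rewrite mul0r add0r.
have V_ge0 w y : 0 <= w -> w <= T -> 0 <= V w y.
  by move=> w0 wT; apply: (policy_value_ge0 p_tf).
have V_norm w y : 0 <= w -> w <= T -> `|V w y| <= N%:R.
  by move=> w0 wT; rewrite ger0_norm ?V_ge0// V_le.
have VK w y : 0 <= w -> w <= T -> (V w y)%:E = pexp p w y T (truncated N).
  move=> w0 wT; rewrite (policy_valueK lambda_ge0 theta_gt0 mu_ge0 p_tf T0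
    (fun _ _ => lexx 0) (fun _ _ => lexx 0) f_ge0 fM y w0 wT).
  rewrite integral0_eq ?add0e// => t _; apply: esum1 => z _.
  by rewrite /average big1 ?mulr0// => a _; rewrite mulr0.
pose F w y := drain lambda theta (T - w) (customersR R y) - V w y.
suff : 0 <= F u x by rewrite -VK// lee_fin subr_ge0.
have back n := policy_value_backward lambda_ge0 theta_gt0 mu_ge0 p_tf T0
    (fun _ _ => lexx 0) (fun _ _ => lexx 0) f_ge0 fM (fun=> ler0n R N) n.
have gen_eq w v y : int_average pi w v y
    (fun a => 0 + action_gen lambda theta mu a (V v) y)
    = int_average pi w v y (fun a => action_gen lambda theta mu a (V v) y).
  by apply: eq_int_average => a _; rewrite add0r.
have FE w v y : F w y - F v y = drain lambda theta (T - v + (v - w)) (customersR R y)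
    - drain lambda theta (T - v) (customersR R y) - (V w y - V v y).
  by rewrite /F addrA subrK; ring.
have d w v y : 0 <= w -> w <= v -> v <= T ->
    (v - w) * (expR (- (theta * (T - v))) * (lambda - theta * customersR R y))
      - lambda * theta * (v - w) ^+ 2
    <= drain lambda theta (T - v + (v - w)) (customersR R y)
      - drain lambda theta (T - v) (customersR R y).
  by move=> w0 wv vT; apply: drain_step => //; rewrite ?subr_ge0//; exact: ler0n.
apply: (@maximum_principle _ _ (fun=> True) (@customers K) T F) => //; last by rewrite u0.
- exists N%:R => w y /andP[w0 wT] _.
  have h1 : 0 <= drain lambda theta (T - w) (customersR R y).
    rewrite addr_ge0 ?mulr_ge0 ?expR_ge0 ?invr_ge0// ?ler0n//.
    by rewrite subr_ge0 expRN_le1// subr_ge0.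
  have h2 : (N%:R : R) <= N%:R * (customers y).+1%:R by rewrite ler_peMr// ler1n.
  apply: (@le_trans _ _ (- V w y)); last by rewrite /F lerDr.
  by rewrite lerN2 (le_trans (V_le w y w0 wT)).
- move=> y _; rewrite /F subrr drain0 /V (policy_value_end p_tf _ T0 f_ge0) subr_ge0.
  by rewrite ler_nat geq_minl.
- move=> n; have [C C0 hC] := back n.
  exists (theta * n%:R + (lambda * theta + C) * T
          + (lambda + theta * n%:R + mu) * (N%:R *+ 2)) => y w v _ yn w0 wv vT.
  have v0 := le_trans w0 wv; have h0 : 0 <= v - w by rewrite subr_ge0.
  have hT : (v - w) ^+ 2 <= T * (v - w).
    by rewrite expr2; apply: ler_wpM2r => //; move: w0 vT; lra.
  have := hC w v y yn w0 wv vT; rewrite -/V gen_eq ler_norml => /andP[_ h1].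
  have : `|int_average pi w v y (fun a => action_gen lambda theta mu a (V v) y)|
      <= (lambda + theta * n%:R + mu) * (N%:R *+ 2) * (v - w).
    apply: int_average_norm => // a fa.
    apply: le_trans (action_gen_norm lambda_ge0 theta_ge0 mu_ge0 fa (fun z _ => V_norm v z v0 vT)) _.
    apply: ler_wpM2r; first by rewrite mulrn_wge0.
    by rewrite lerD2r lerD2l ler_wpM2l// ler_nat.
  rewrite ler_norml => /andP[_ h2].
  have := d w v y w0 wv vT; set E := expR _ => h3.
  have E0 : 0 <= E by exact: expR_ge0.
  have E1 : E <= 1 by rewrite expRN_le1// subr_ge0.
  have h4 : (v - w) * (E * (lambda - theta * customersR R y)) >= - (theta * n%:R * (v - w)).
    rewrite [leRHS]mulrC -mulNr; apply: ler_wpM2r => //.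
    have h5 : theta * customersR R y <= theta * n%:R by rewrite ler_wpM2l// ler_nat.
    have h6 : E * (theta * customersR R y) <= theta * customersR R y.
      by rewrite ler_piMl// mulr_ge0// ler0n.
    have := mulr_ge0 E0 lambda_ge0; move: h5 h6; lra.
  have h7 : (lambda * theta + C) * (v - w) ^+ 2 <= (lambda * theta + C) * (T * (v - w)).
    by apply: ler_wpM2l => //; rewrite addr_ge0// mulr_ge0.
  by rewrite FE; move: h1 h2 h3 h4 h7; lra.
- exists (lambda *+ 3) => n; have [C C0 hC] := back n.
  exists (lambda + theta * n%:R + mu + (lambda * theta + C)).
  move=> y w v b eta _ yn w0 wv vT b0 eta0 Fge Fle.
  have v0 := le_trans w0 wv; have h0 : 0 <= v - w by rewrite subr_ge0.
  have := hC w v y yn w0 wv vT; rewrite -/V gen_eq ler_norml => /andP[_ h1].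
  have h3 := d w v y w0 wv vT.
  set c := expR _ * _ in h3.
  have h2 : - (lambda *+ 3 * (b * weight R (customers y))
      + (lambda + theta * n%:R + mu) * eta) * (v - w)
      <= c * (v - w) - int_average pi w v y (fun a => action_gen lambda theta mu a (V v) y).
    rewrite -(int_average_cst pi y c w0 wv) int_averageB//; apply: int_average_ge => // a fa.
    apply: le_trans (action_gen_ge lambda_ge0 theta_ge0 mu_ge0 fa yn b0 eta0
      (fun z => Fge z I) Fle) _.
    rewrite action_genB lerD2r /drain.
    rewrite (_ : (fun z => _) = (fun z => expR (- (theta * (T - v))) * customersR R z
      + 1 * (fun=> lambda / theta * (1 - expR (- (theta * (T - v))))) z)); last first.
      by apply/funext => z; rewrite mul1r.
    (* Completions only remove customers, so the reward term is dropped. *)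
    rewrite action_genD action_gen_cst mulr0 addr0 action_gen_customers//.
    rewrite /c; apply: ler_wpM2l; first exact: expR_ge0.
    by rewrite gerBl /reward mulr_ge0.
  have h4 : (lambda + theta * n%:R + mu) * (v - w) * (v - w) >= 0.
    by rewrite !mulr_ge0// !addr_ge0// mulr_ge0.
  have h5 : 0 <= (lambda * theta + C) * eta * (v - w).
    by rewrite !mulr_ge0// addr_ge0// mulr_ge0.
  by rewrite FE; move: h1 h2 h3 h4 h5; lra.
Qed.

Lemma moment T u x : 0 <= u -> u <= T ->
  (pexp p u x T (@customersR R K) <= (drain lambda theta (T - u) (customersR R x))%:E)%E.
Proof.
move=> u0 uT; apply: ge_ereal_sup => _ [/= X [finX _] <-].
(* On a finite set of states a large enough truncation has no effect. *)
pose N := (\sum_(y \in X) customers y)%N.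
apply: le_trans (truncated_moment N x u0 uT); apply: esum_ge; exists X => //.
apply: lee_fsum => // y Xy; rewrite lee_fin; apply: ler_wpM2l.
  exact: (p_ge0 p_tf).
rewrite ler_nat leq_min leqnn /N fsbig_finite//= (bigD1_seq y)//= ?leq_addr//.
by rewrite in_fset_set// inE.
Qed.

End Moment.

(** * Optimality of SREPT on a finite horizon *)

Section Excess.
Context (R : realType) (K : nat) (lambda theta mu : R).
Hypotheses (K_gt0 : (0 < K)%N).
Hypotheses (lambda_ge0 : 0 <= lambda) (theta_gt0 : 0 < theta) (mu_ge0 : 0 <= mu).
Variables (pi : policy R K) (p : R -> state K -> R -> state K -> R).
Hypothesis p_tf : is_transition_function (policy_rate lambda theta mu pi) p.
Variable T : R.
Hypothesis T_ge0 : 0 <= T.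
Implicit Types (u v t : R) (x y z : state K).

Let theta_ge0 : 0 <= theta. Proof. exact: ltW. Qed.

Definition completions : R -> state K -> R :=
  policy_value pi p T (@reward R K mu) (@customersR R K).

(* The expected abandonments on [u, T] minus the expected arrivals. *)
Definition excess u x : R := customersR R x - completions u x.

Let bound x : R := customersR R x + lambda / theta.

Let lt_ge0 : 0 <= lambda / theta. Proof. by rewrite divr_ge0. Qed.

Let c_ge0 x : 0 <= customersR R x. Proof. exact: ler0n. Qed.

Lemma reward_ge0 x (a : action K) : 0 <= reward mu x a.
Proof. by rewrite mulr_ge0. Qed.

Lemma reward_le x (a : action K) : reward mu x a <= mu.
Proof. by rewrite ler_piMr// lern1 leq_b1. Qed.

Let pexp_bound u x : 0 <= u -> u <= T ->
  (pexp p u x T (@customersR R K) <= (bound x)%:E)%E.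
Proof.
move=> u0 uT; apply: le_trans (moment K_gt0 lambda_ge0 theta_gt0 mu_ge0 p_tf x u0 uT) _.
by rewrite lee_fin drain_le// subr_ge0.
Qed.

Lemma completions_ge0 u x : 0 <= u -> u <= T -> 0 <= completions u x.
Proof. exact: (policy_value_ge0 p_tf reward_ge0 c_ge0). Qed.

Definition excess_cst : R := mu * T + lambda / theta.

Lemma excess_cst_ge0 : 0 <= excess_cst.
Proof. by rewrite addr_ge0// mulr_ge0. Qed.

Lemma excess_norm u x : 0 <= u -> u <= T ->
  `|excess u x| <= customersR R x + excess_cst.
Proof.
move=> u0 uT; have h1 := completions_ge0 x u0 uT.
have h2 : completions u x <= mu * T + bound x.
  exact: (policy_value_le lambda_ge0 theta_gt0 mu_ge0 p_tf T_ge0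
    reward_ge0 reward_le c_ge0 pexp_bound x u0 uT).
have h3 := excess_cst_ge0; have h4 := c_ge0 x.
rewrite ler_norml; move: h1 h2 h3 h4; rewrite /excess /excess_cst /bound => *.
by apply/andP; split; lra.
Qed.

Lemma excess_end x : excess T x = 0.
Proof. by rewrite /excess /completions (policy_value_end p_tf _ T_ge0 c_ge0) subrr. Qed.

Lemma cost_gen_action (a : action K) h x :
  cost_gen lambda theta mu a h x
  = theta * customersR R x - lambda + action_gen lambda theta mu a h x.
Proof. by rewrite /cost_gen /action_gen /customersR; ring. Qed.

Lemma excess_backward n :
  exists2 C : R, 0 <= C & forall u v x, (customers x <= n)%N -> 0 <= u -> u <= v -> v <= T ->
  `|excess u x - excess v x
    - int_average pi u v x (fun a => cost_gen lambda theta mu a (excess v) x)|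
  <= C * (v - u) ^+ 2.
Proof.
have bound_ge0 y : 0 <= bound y by rewrite addr_ge0.
have [C C0 hC] := policy_value_backward lambda_ge0 theta_gt0 mu_ge0 p_tf T_ge0
    reward_ge0 reward_le c_ge0 pexp_bound bound_ge0 n.
exists C => // u v x xn u0 uv vT; apply: le_trans (hC u v x xn u0 uv vT).
rewrite -normrN le_eqVlt; apply/orP; left; apply/eqP; congr `|_|.
rewrite [in RHS](@eq_int_average _ _ pi u v x _
    (fun a => 0 - cost_gen lambda theta mu a (excess v) x)).
  rewrite -int_averageB// int_average_cst// mul0r /excess /completions; ring.
move=> a fa; rewrite cost_gen_action /excess action_genB action_gen_customers//.
by rewrite -/completions; ring.
Qed.

Lemma cost_gen_norm (a : action K) h x (D : R) : a \in feasible x ->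
  (forall y, (customers y <= (customers x).+1)%N -> `|h y| <= D) ->
  `|cost_gen lambda theta mu a h x| <= theta * customersR R x + lambda
    + (lambda + theta * customersR R x + mu) * (D *+ 2).
Proof.
move=> fa hD; rewrite cost_gen_action; apply: le_trans (ler_normD _ _) _.
apply: lerD (action_gen_norm lambda_ge0 theta_ge0 mu_ge0 fa hD).
apply: le_trans (ler_normB _ _) _; rewrite (ger0_norm lambda_ge0) ger0_norm//.
by rewrite mulr_ge0.
Qed.

Definition cost_bound n : R := theta * n%:R + lambda
  + (lambda + theta * n%:R + mu) * ((n.+1%:R + excess_cst) *+ 2).

Lemma cost_gen_excess_norm (a : action K) v x n : 0 <= v -> v <= T ->
  a \in feasible x -> (customers x <= n)%N ->
  `|cost_gen lambda theta mu a (excess v) x| <= cost_bound n.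
Proof.
move=> v0 vT fa xn; have E0 := excess_cst_ge0.
have cn : customersR R x <= n%:R by rewrite ler_nat.
have tn : theta * customersR R x <= theta * n%:R by rewrite ler_wpM2l.
apply: le_trans (cost_gen_norm fa (D := n.+1%:R + excess_cst) _) _.
  move=> y yx; apply: le_trans (excess_norm y v0 vT) _.
  by rewrite lerD2r ler_nat (leq_trans yx)// ltnS.
rewrite /cost_bound; apply: lerD; first by rewrite lerD2r.
apply: ler_wpM2r; last by rewrite lerD2r lerD2l.
by rewrite mulrn_wge0// addr_ge0// ler0n.
Qed.

End Excess.

Section SreptInequalities.
Context (R : realType) (K : nat) (lambda theta mu : R).
Hypotheses (K_gt0 : (0 < K)%N).
Hypotheses (lambda_ge0 : 0 <= lambda) (theta_gt0 : 0 < theta) (mu_gt0 : 0 < mu).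
Variable p : R -> state K -> R -> state K -> R.
Hypothesis p_tf : is_transition_function (policy_rate lambda theta mu (srept R K)) p.
Variable T : R.
Hypothesis T_ge0 : 0 <= T.
Implicit Types (u v t : R) (x y z : state K).

Let theta_ge0 : 0 <= theta. Proof. exact: ltW. Qed.
Let mu_ge0 : 0 <= mu. Proof. exact: ltW. Qed.

Local Notation Z := (excess mu (srept R K) p T).

Lemma ineq_lin_le (k : ineq K) (f : state K -> R) :
  ineq_lin theta mu k f <= ineq_val theta mu k f.
Proof. by rewrite /ineq_val lerDr; case: k. Qed.

Lemma ineq_linB (k : ineq K) (f1 f2 g : state K -> R) (h : R) :
  ineq_lin theta mu k f1 - ineq_lin theta mu k f2 - h * ineq_lin theta mu k g
  = ineq_lin theta mu k (fun y => f1 y - f2 y - h * g y).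
Proof. by case: k => [j s|i s|i j s|i j s] /=; ring. Qed.

Lemma srept_excess_backward n :
  exists2 C : R, 0 <= C & forall u v x, (customers x <= n)%N -> 0 <= u -> u <= v -> v <= T ->
  `|Z u x - Z v x - (v - u) * srept_gen lambda theta mu (Z v) x| <= C * (v - u) ^+ 2.
Proof.
have [C C0 hC] := excess_backward K_gt0 lambda_ge0 theta_gt0 mu_ge0 p_tf T_ge0 n.
exists C => // u v x xn u0 uv vT; apply: le_trans (hC u v x xn u0 uv vT).
by rewrite int_average_srept// mulrC.
Qed.

Definition lin_cst : R := mu *+ 2 + theta *+ 2 + 2.
Local Notation c := lin_cst.

Lemma lin_cst_ge0 : 0 <= lin_cst.
Proof. by rewrite !addr_ge0// ?mulrn_wge0// ?ler0n. Qed.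

Lemma srept_ineq_diff n : exists2 C : R, 0 <= C & forall u v (k : ineq K),
  (customers (ineq_base k) <= n)%N -> 0 <= u -> u <= v -> v <= T ->
  `|ineq_val theta mu k (Z u) - ineq_val theta mu k (Z v)
    - (v - u) * ineq_lin theta mu k (srept_gen lambda theta mu (Z v))|
  <= C * (v - u) ^+ 2.
Proof.
(* An inequality involves states with up to two customers more than its base. *)
have [C C0 hC] := srept_excess_backward n.+2.
exists (c * C); first by rewrite mulr_ge0// lin_cst_ge0.
move=> u v k kn u0 uv vT.
have -> : ineq_val theta mu k (Z u) - ineq_val theta mu k (Z v)
    = ineq_lin theta mu k (Z u) - ineq_lin theta mu k (Z v).
  by rewrite /ineq_val opprD addrACA subrr add0r.
rewrite ineq_linB -mulrA; apply: ineq_lin_norm => //.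
  by rewrite mulr_ge0// sqr_ge0.
by move=> y yk; apply: hC => //; apply: leq_trans yk _; rewrite !ltnS.
Qed.

Lemma srept_ineq u (k : ineq K) : 0 <= u <= T -> ineq_ok k -> 0 <= ineq_val theta mu k (Z u).
Proof.
pose A := excess_cst lambda theta mu T.
have A0 : 0 <= A by exact: excess_cst_ge0.
have Z_norm v y : 0 <= v -> v <= T -> `|Z v y| <= customersR R y + A.
  by move=> v0 vT; exact: (excess_norm K_gt0 lambda_ge0 theta_gt0 mu_ge0 p_tf T_ge0).
apply: (@maximum_principle _ _ (fun k => ineq_ok k : Prop)
  (fun k => customers (ineq_base k)) T (fun u k => ineq_val theta mu k (Z u))).
- exists (1 + c * (2 + A)) => v j /andP[v0 vT] _; set n := customers _.
  have h1 : `|ineq_lin theta mu j (Z v)| <= c * (n.+2%:R + A).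
    apply: ineq_lin_norm => //; first by rewrite addr_ge0// ler0n.
    by move=> y yn; apply: le_trans (Z_norm v y v0 vT) _; rewrite lerD2r ler_nat.
  have h2 : n.+2%:R + A <= (2 + A) * n.+1%:R.
    have : 0 <= A * n%:R by rewrite mulr_ge0// ler0n.
    have : (0 : R) <= n%:R by rewrite ler0n.
    by rewrite -!natr1; lra.
  have h3 := ler_wpM2l lin_cst_ge0 h2.
  have h4 : (1 : R) <= n.+1%:R by rewrite ler1n.
  apply: le_trans (ineq_lin_le j (Z v)).
  by move: h1; rewrite ler_norml => /andP[h1 _]; move: h1 h3 h4; lra.
- have -> : Z T = fun=> 0.
    by apply/funext => y; exact: (excess_end p_tf T_ge0).
  by move=> j _; case: j => [j s|i s|i j s|i j s]; rewrite /ineq_val /=; lra.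
- move=> n; have [C C0 hC] := srept_ineq_diff n.
  exists (c * cost_bound lambda theta mu T n.+2 + C * T) => j u' v _ jn u0 uv vT.
  have v0 := le_trans u0 uv; have h0 : 0 <= v - u' by rewrite subr_ge0.
  have h1 : `|ineq_lin theta mu j (srept_gen lambda theta mu (Z v))|
      <= c * cost_bound lambda theta mu T n.+2.
    apply: ineq_lin_norm => //.
      apply: le_trans (normr_ge0 _) (cost_gen_excess_norm K_gt0 lambda_ge0 theta_gt0
        mu_ge0 p_tf T_ge0 v0 vT (feasible0 [ffun=> 0%N]) _).
      by rewrite /customers big1// => i _; rewrite ffunE.
    move=> y yn; apply: (cost_gen_excess_norm K_gt0 lambda_ge0 theta_gt0
      mu_ge0 p_tf T_ge0 v0 vT (srept_action_feasible y)).
    by rewrite (leq_trans yn).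
  have h2 : C * (v - u') ^+ 2 <= C * T * (v - u').
    rewrite expr2 mulrA; apply: ler_wpM2r => //; apply: ler_wpM2l => //.
    by move: u0 vT; lra.
  have := hC u' v j jn u0 uv vT; rewrite ler_norml => /andP[h3 _].
  move: h1; rewrite ler_norml => /andP[h1 _].
  have h4 := ler_wpM2l h0 h1.
  by move: h2 h3 h4; lra.
(* The factor making [tau = ctau * t] satisfy both [t <= tau] and
   [(1 + theta * K) * t <= mu * tau]. *)
- pose ctau : R := 1 + (1 + theta * K%:R) / mu.
  have ctau1 : 1 <= ctau by rewrite lerDl divr_ge0// addr_ge0// mulr_ge0.
  have cst0 : 0 <= step_cst lambda theta mu.
    by rewrite /step_cst !addr_ge0 ?mulr_ge0 ?addr_ge0 ?mulrn_wge0.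
  exists (step_cst lambda theta mu * ctau *+ 4) => n.
  have [C C0 hC] := srept_ineq_diff n.
  exists (lambda + theta *+ 2 + mu + theta * n%:R + C).
  move=> j u' v b eta jok jn u0 uv vT b0 eta0 Fge Fle.
  have v0 := le_trans u0 uv; have h0 : 0 <= v - u' by rewrite subr_ge0.
  have wb i l : (i <= l)%N -> b * weight R i <= b * weight R l.
    move=> il; apply: ler_wpM2l => //; rewrite /weight lerXn2r ?nnegrE//.
    by rewrite ler_nat.
  set n' := customers (ineq_base j) in jn Fle *.
  (* Tolerance one level up, since arrivals and comparisons of actions need level [n'.+1]; it is at
     most 4 times that of level [n'], whence the factor 4 in [Gamma]. *)
  pose t := b * weight R n'.+1.
  have t0 : 0 <= t by rewrite mulr_ge0// (le_trans ler01)// weight_ge1.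
  have w0 : 0 <= b * weight R n' by rewrite mulr_ge0// (le_trans ler01)// weight_ge1.
  have t4 : t <= b * weight R n' *+ 4.
    rewrite -mulrnAr; apply: ler_wpM2l => //; rewrite /weight.
    rewrite -[_ ^+ 2 *+ 4]mulr_natr -!natrX -natrM ler_nat.
    by rewrite -[4%N]/(2 ^ 2)%N -expnMn leq_exp2r//; nlia.
  have lower i l : ineq_ok l -> (customers (ineq_base l) <= i)%N ->
      - (b * weight R i) <= ineq_val theta mu l (Z v).
    by move=> lok li; apply: le_trans (Fge l lok); rewrite lerN2 wb.
  have mtau : (1 + theta * K%:R) * t <= mu * (ctau * t).
    have -> : mu * (ctau * t) = mu * t + (1 + theta * K%:R) * t.
      by rewrite /ctau; field; rewrite gt_eqF.
    by rewrite lerDr mulr_ge0.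
  have ttau : t <= ctau * t by rewrite ler_peMl.
  have v1 : ineq_val theta mu j (Z v) <= eta by move: Fle w0; lra.
  have v2 : b * weight R n' + ineq_val theta mu j (Z v) <= eta by move: Fle; lra.
  have key := ineq_step lambda_ge0 theta_ge0 mu_gt0 t0 (lower n'.+1) ttau mtau
    (erefl n'.+1) eta0 (lower n') jok (erefl n') v1 v2.
  have h1 : step_slack lambda theta mu (ctau * t) n' eta
      <= (lambda + theta *+ 2 + mu + theta * n%:R) * eta
         + step_cst lambda theta mu * ctau *+ 4 * (b * weight R n').
    rewrite /step_slack; apply: lerD.
      by apply: ler_wpM2r => //; rewrite lerD2l ler_wpM2l// ler_nat.
    have c0 : 0 <= step_cst lambda theta mu * ctau by rewrite mulr_ge0// (le_trans ler01).
    by have := ler_wpM2l c0 t4; lra.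
  have h2 := ler_wpM2l h0 key; have h3 := ler_wpM2l h0 h1.
  have := hC u' v j jn u0 uv vT; rewrite ler_norml => /andP[h4 _].
  have h5 : 0 <= C * eta * (v - u') by rewrite !mulr_ge0.
  have h6 : 0 <= (lambda + theta *+ 2 + mu + theta * n%:R) * (v - u') * (v - u').
    by rewrite !mulr_ge0// !addr_ge0 ?mulr_ge0 ?mulrn_wge0.
  by move: h2 h3 h4 h5 h6; lra.
Qed.

Lemma srept_optimal_action u x (a : action K) : 0 <= u <= T -> a \in feasible x ->
  Z u (serve x (srept_action x)) <= Z u (serve x a).
Proof.
move=> uT fa; rewrite -[leRHS]addr0.
apply: (srept_serve_tol (N := customers x) (t := 0) lambda_ge0 theta_ge0 mu_gt0) => //.
- by move=> k kok _; rewrite oppr0; exact: srept_ineq.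
- by rewrite !mulr0.
Qed.

End SreptInequalities.

Section Comparison.
Context (R : realType) (K : nat) (lambda theta mu : R).
Hypotheses (K_gt0 : (0 < K)%N).
Hypotheses (lambda_ge0 : 0 <= lambda) (theta_gt0 : 0 < theta) (mu_gt0 : 0 < mu).
Variables (pi : policy R K) (p ps : R -> state K -> R -> state K -> R).
Hypothesis p_tf : is_transition_function (policy_rate lambda theta mu pi) p.
Hypothesis ps_tf : is_transition_function (policy_rate lambda theta mu (srept R K)) ps.
Variable T : R.
Hypothesis T_ge0 : 0 <= T.
Implicit Types (u v t : R) (x y z : state K).

Let theta_ge0 : 0 <= theta. Proof. exact: ltW. Qed.
Let mu_ge0 : 0 <= mu. Proof. exact: ltW. Qed.

Local Notation Zp := (excess mu pi p T).
Local Notation Zs := (excess mu (srept R K) ps T).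
Local Notation gen := (cost_gen lambda theta mu).

(** The Hamilton-Jacobi-Bellman inequality: the action enters [cost_gen] only through
    [z (serve x a)], and the tolerance in the comparison of actions is now zero. *)
Lemma srept_gen_le v x (a : action K) : 0 <= v <= T -> a \in feasible x ->
  srept_gen lambda theta mu (Zs v) x <= gen a (Zs v) x.
Proof.
move=> vT fa; rewrite lerD2l; apply: ler_wpM2l => //; rewrite lerD2r.
exact: (srept_optimal_action K_gt0 lambda_ge0 theta_gt0 mu_gt0 ps_tf T_ge0).
Qed.

Theorem srept_excess_le u x : 0 <= u <= T -> Zs u x <= Zp u x.
Proof.
move=> uT; rewrite -subr_ge0; move: u x uT => u x uT.
pose A := excess_cst lambda theta mu T.
have A0 : 0 <= A by exact: excess_cst_ge0.
have Zp_norm v y : 0 <= v -> v <= T -> `|Zp v y| <= customersR R y + A.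
  by move=> v0 vT; exact: (excess_norm K_gt0 lambda_ge0 theta_gt0 mu_ge0 p_tf T_ge0).
have Zs_norm v y : 0 <= v -> v <= T -> `|Zs v y| <= customersR R y + A.
  by move=> v0 vT; exact: (excess_norm K_gt0 lambda_ge0 theta_gt0 mu_ge0 ps_tf T_ge0).
pose F v y := Zp v y - Zs v y.
have diff n : exists2 C : R, 0 <= C & forall w v y,
    (customers y <= n)%N -> 0 <= w -> w <= v -> v <= T ->
    int_average pi w v y (fun a => gen a (Zp v) y - srept_gen lambda theta mu (Zs v) y)
      - C * (v - w) ^+ 2 <= F w y - F v y.
  have [C1 C10 hC1] := excess_backward K_gt0 lambda_ge0 theta_gt0 mu_ge0 p_tf T_ge0 n.
  have [C2 C20 hC2] := srept_excess_backward K_gt0 lambda_ge0 theta_gt0 mu_gt0 ps_tf T_ge0 n.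
  exists (C1 + C2); first by rewrite addr_ge0.
  move=> w v y yn w0 wv vT; rewrite -int_averageB// int_average_cst//.
  have := hC1 w v y yn w0 wv vT; have := hC2 w v y yn w0 wv vT.
  rewrite !ler_norml => /andP[_ h1] /andP[h2 _]; rewrite /F.
  by move: h1 h2; lra.
apply: (@maximum_principle _ _ (fun=> True) (@customers K) T F _ _ _ _ u x uT) => //.
- exists ((1 + A) *+ 2) => v y /andP[v0 vT] _.
  have := Zp_norm v y v0 vT; have := Zs_norm v y v0 vT.
  rewrite !ler_norml => /andP[_ h1] /andP[h2 _].
  have h3 : 0 <= A * (customers y)%:R by rewrite mulr_ge0// ler0n.
  have h4 : (0 : R) <= (customers y)%:R by rewrite ler0n.
  rewrite /F -natr1; move: h1 h2 h3 h4; rewrite /customersR; lra.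
- by move=> y _; rewrite /F (excess_end p_tf T_ge0) (excess_end ps_tf T_ge0) subrr.
- move=> n; have [C C0 hC] := diff n.
  exists (cost_bound lambda theta mu T n *+ 2 + C * T) => y w v _ yn w0 wv vT.
  have v0 := le_trans w0 wv; have h0 : 0 <= v - w by rewrite subr_ge0.
  apply: le_trans (hC w v y yn w0 wv vT).
  have h2 : C * (v - w) ^+ 2 <= C * T * (v - w).
    rewrite expr2 mulrA; apply: ler_wpM2r => //; apply: ler_wpM2l => //.
    by move: w0 vT; lra.
  have : - (cost_bound lambda theta mu T n *+ 2) * (v - w) <= int_average pi w v y
      (fun a => gen a (Zp v) y - srept_gen lambda theta mu (Zs v) y).
    apply: int_average_ge => // a fa.
    have := cost_gen_excess_norm K_gt0 lambda_ge0 theta_gt0 mu_ge0 p_tf T_ge0 v0 vT fa yn.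
    have := cost_gen_excess_norm K_gt0 lambda_ge0 theta_gt0 mu_ge0 ps_tf T_ge0 v0 vT
      (srept_action_feasible y) yn.
    rewrite !ler_norml => /andP[_ h3] /andP[h4 _].
    by rewrite /srept_gen; move: h3 h4; lra.
  by move: h2; lra.
- exists (lambda *+ 3) => n; have [C C0 hC] := diff n.
  exists (lambda + theta * n%:R + mu + C).
  move=> y w v b eta _ yn w0 wv vT b0 eta0 Fge Fle.
  have v0 := le_trans w0 wv; have h0 : 0 <= v - w by rewrite subr_ge0.
  apply: le_trans (hC w v y yn w0 wv vT).
  have h2 : - (lambda *+ 3 * (b * weight R (customers y))
      + (lambda + theta * n%:R + mu) * eta) * (v - w) <= int_average pi w v y
      (fun a => gen a (Zp v) y - srept_gen lambda theta mu (Zs v) y).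
    apply: int_average_ge => // a fa.
    apply: le_trans (action_gen_ge lambda_ge0 theta_ge0 mu_ge0 fa yn b0 eta0
      (fun z => Fge z I) Fle) _.
    have vT' : 0 <= v <= T by rewrite v0.
    (* Giving both values the action [a] of the policy cancels the running costs and leaves the
       generator of the difference [F]. *)
    have := srept_gen_le vT' fa; rewrite /F action_genB !cost_gen_action; lra.
  have h4 : (lambda + theta * n%:R + mu) * (v - w) * (v - w) >= 0.
    by rewrite !mulr_ge0// !addr_ge0// mulr_ge0.
  have h5 : 0 <= C * eta * (v - w) by rewrite !mulr_ge0.
  by move: h2 h4 h5; lra.
Qed.

Corollary srept_completions_ge u x : 0 <= u <= T ->
  completions mu pi p T u x <= completions mu (srept R K) ps T u x.
Proof. by move=> uT; have := srept_excess_le x uT; rewrite lerD2l lerN2. Qed.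

End Comparison.

(** * Long-run average throughput *)

Section Marginals.
Context (R : realType) (S : countType) (q : R -> S -> S -> R) (s : S).
Context (d : measure_display) (Omega : measurableType d) (P : probability Omega R).
Variable X : R -> Omega -> S.
Hypothesis X_meas : forall y, measurable
  [set tw : measurableTypeR R * Omega | 0 <= tw.1 /\ X tw.1 tw.2 = y].
Hypothesis X0 : P [set w | X 0 w = s] = 1%E.
Variable p : R -> S -> R -> S -> R.
Hypothesis p_X : forall (n : nat) (t : nat -> R) (y : nat -> S),
  0 <= t 0%N -> (forall i, t i <= t i.+1) ->
  P (\bigcap_(i < n.+2) [set w | X (t i) w = y i])
  = (P (\bigcap_(i < n.+1) [set w | X (t i) w = y i])
     * (p (t n) (y n) (t n.+1) (y n.+1))%:E)%E.

Definition visits y : set (measurableTypeR R * Omega) :=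
  [set tw | 0 <= tw.1 /\ X tw.1 tw.2 = y].

Lemma xsection_visits t y : 0 <= t -> xsection (visits y) t = [set w | X t w = y].
Proof. by move=> t0; apply/seteqP; split=> w; rewrite /xsection /= inE /= => // -[]. Qed.

Lemma measurable_at t y : 0 <= t -> measurable [set w | X t w = y].
Proof. by move=> t0; rewrite -xsection_visits//; apply: measurable_xsection; exact: X_meas. Qed.

(** The two-time product formula gives the law on the event [X 0 = s], which has full measure. *)
Lemma marginal t y : 0 <= t -> P [set w | X t w = y] = (p 0 s t y)%:E.
Proof.
move=> t0; set B := [set w | X t w = y]; set A := [set w | X 0 w = s].
have mA : measurable A by exact: measurable_at.
have mB : measurable B by exact: measurable_at.
have := @p_X 0%N (fun i => if i is 0%N then 0 else t) (fun i => if i is 0%N then s else y)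
  (lexx 0).
move=> /(_ ltac:(by case)).
rewrite !bigcap_mkord !big_ord_recl !big_ord0 !setIT /= -/A -/B X0 mul1e => <-.
have BA : P (B `\` A) = 0%E.
    apply: (subset_measure0 (B := ~` A)); [exact: measurableD|exact: measurableC|by move=> w []|].
    have := probability_setC P mA; rewrite X0 subee//.
have -> : P B = (P (B `\` A) + P (B `&` A))%E := measureDI P mB mA.
by rewrite BA add0e setIC.
Qed.

Variables (T m : R) (rew : R -> S -> R).
Hypothesis T_ge0 : 0 <= T.
Hypothesis rew_ge0 : forall t y, 0 <= t -> 0 <= rew t y.
Hypothesis rew_le : forall t y, 0 <= t -> rew t y <= m.
Hypothesis rew_meas : forall y, measurable_fun `[0 : R, +oo[%classic (rew^~ y).
Hypothesis p_tf : is_transition_function q p.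

Local Notation leb := (@lebesgue_measure R).

Let stopped y : R -> R := (rew^~ y) \_ `[0, T]%classic.

Let stopped_ge0 y t : 0 <= stopped y t.
Proof.
rewrite /stopped patchE; case: ifPn => // /[!inE] /=; rewrite in_itv /= => /andP[t0 _].
exact: rew_ge0.
Qed.

Let stopped_meas y : measurable_fun [set: measurableTypeR R] (stopped y).
Proof.
apply: iffLR (measurable_restrictT _ _) _ => //.
apply: measurable_funS (rew_meas y) => //.
by move=> t /=; rewrite !in_itv /= => /andP[-> _].
Qed.

(** Summed over [y] this is the reward along the path, so measurability and Tonelli can be handled
    one state at a time. *)
Let density y (tw : measurableTypeR R * Omega) : R := \1_(visits y) tw * stopped y tw.1.

Let density_ge0 y tw : 0 <= density y tw.
Proof. by rewrite mulr_ge0// indicE ler0n. Qed.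

Let density_meas y : measurable_fun setT (EFin \o density y).
Proof.
apply/measurable_EFinP; apply: measurable_funM.
  by apply: measurable_indic; exact: X_meas.
by apply: measurableT_comp => //; exact: stopped_meas.
Qed.

Let esum_density t w :
  (\esum_(y in [set: S]) (density y (t, w))%:E
   = (((fun u => rew u (X u w)) \_ `[0, T]%classic) t)%:E)%E.
Proof.
rewrite patchE; case: ifPn => [/[!inE] tT|tT]; last first.
  by rewrite esum1// => y _; rewrite /density /stopped patchE (negbTE tT) mulr0.
rewrite -(@esum_set1 _ _ (X t w) (fun y => (rew t y)%:E)); last first.
  by rewrite lee_fin; move: tT => /=; rewrite in_itv /= => /andP[t0 _]; exact: rew_ge0.
rewrite [RHS]esum_mkcond; apply: eq_esum => y _.
have t0 : 0 <= t by move: tT => /=; rewrite in_itv /= => /andP[].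
rewrite /density /stopped patchE mem_set//= indicE.
have [->|yX] := eqVneq y (X t w).
  by rewrite !mem_set ?mul1r//=.
rewrite !memNset ?mul0r//= => [/eqP|[_ /eqP]]; first by rewrite (negbTE yX).
by rewrite eq_sym (negbTE yX).
Qed.

Let path_meas w : measurable_fun setT
  (fun t : measurableTypeR R => (((fun u => rew u (X u w)) \_ `[0, T]%classic) t)%:E).
Proof.
have md : measurable_fun setT (fun t : measurableTypeR R =>
    (\esum_(y in [set: S]) (density y (t, w))%:E)%E).
  apply: measurable_fun_esum => //.
  - by move=> y; exact: (measurable_fun_pair1 w (density_meas y)).
  - by move=> y t _; rewrite lee_fin.
apply: eq_measurable_fun md => t _; exact: esum_density.
Qed.

Let path_integral w :
  ((\int[leb]_(t in `[0, T]) rew t (X t w))%:E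
   = \int[leb]_t \esum_(y in [set: S]) (density y (t, w))%:E)%E.
Proof.
rewrite (@EFin_Rintegral_itv _ _ _ m).
- rewrite integral_mkcond; apply: eq_integral => t _.
  by rewrite esum_density restrict_EFin.
- apply/measurable_restrictT => //; apply/measurable_EFinP; exact: path_meas.
- by move=> t /andP[t0 _]; rewrite ger0_norm ?rew_ge0// rew_le.
Qed.

Let p_meas_t y : measurable_fun `[0, T]%classic (fun t => p 0 s t y).
Proof.
apply/measurable_EFinP.
have := measurable_funTS (D := `[0, T]%classic) (measurable_fun_xsection P (X_meas y)).
apply: eq_measurable_fun => t; rewrite inE /= in_itv /= => /andP[t0 _].
by rewrite /= -(marginal y t0) -xsection_visits.
Qed.

Lemma expected_path_integral :
  ('E_P[fun w => (\int[leb]_(t in `[0, T]) rew t (X t w))%R]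
   = \int[leb]_(t in `[0%R, T]) pexp p 0 s t (rew t))%E.
Proof.
rewrite unlock.
under eq_integral => w _.
  rewrite path_integral integral_esum//; last 2 first.
  - by move=> y; exact: (measurable_fun_pair1 w (density_meas y)).
  - by move=> y t _; rewrite lee_fin.
  over.
rewrite integral_esum//; last 2 first.
- move=> y; have d0 tw : (0 <= (EFin \o density y) tw)%E by rewrite lee_fin.
  exact: (@measurable_fun_fubini_tonelli_G _ _ _ _ _ leb _ (density_meas y) d0).
- by move=> y w _; apply: integral_ge0 => t _; rewrite lee_fin.
rewrite /pexp integral_esum//; last 2 first.
- move=> y; apply/measurable_EFinP; apply: measurable_funM; first exact: p_meas_t.
  apply: measurable_funS (rew_meas y) => //.
  by move=> t /=; rewrite !in_itv /= => /andP[-> _].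
- move=> y t /=; rewrite in_itv /= => /andP[t0 _].
  by rewrite lee_fin mulr_ge0 ?rew_ge0// (p_ge0 p_tf).
apply: eq_esum => y _.
rewrite -(fubini_tonelli (m1 := leb) (m2 := P) (EFin \o density y))//; last first.
  by move=> tw; rewrite lee_fin.
rewrite [RHS]integral_mkcond; apply: eq_integral => t _.
rewrite patchE; case: ifPn => [/[!inE] tT|tT]; last first.
  rewrite integral0_eq// => w _; rewrite /density /stopped /= patchE (negbTE tT).
  by rewrite mulr0.
have t0 : 0 <= t by move: tT => /=; rewrite in_itv /= => /andP[].
transitivity (\int[P]_w ((rew t y)%:E * (\1_(xsection (visits y) t) w)%:E))%E.
  apply: eq_integral => w _; rewrite -EFinM mulrC /= /density /stopped patchE mem_set//.
  by rewrite !indicE mem_xsection.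
rewrite ge0_integralZl//; last 2 first.
- by apply/measurable_EFinP; apply: measurable_indic; apply: measurable_xsection; exact: X_meas.
- by rewrite lee_fin rew_ge0.
rewrite integral_indic// ?setIT; last by apply: measurable_xsection; exact: X_meas.
by rewrite xsection_visits// EFinM muleC; congr (_ * _)%E; exact: marginal.
Qed.

End Marginals.

Section RewardBounds.
Context (R : realType) (K : nat) (lambda theta mu : R).
Hypotheses (K_gt0 : (0 < K)%N).
Hypotheses (lambda_ge0 : 0 <= lambda) (theta_gt0 : 0 < theta) (mu_ge0 : 0 <= mu).
Variables (pi : policy R K) (s : state K) (X : controlled_chain lambda theta mu pi s).
Local Notation leb := (@lebesgue_measure R).

(** [completions] exceeds the expected reward by the expected number of customers at [T], which is
    bounded uniformly in [T]. *)
Lemma total_reward_completions T : 0 <= T ->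
  exists2 p, is_transition_function (policy_rate lambda theta mu pi) p &
    ('E_(chain_prob X)[@total_reward _ _ _ _ _ pi s X T] <= (completions mu pi p T 0 s)%:E
     <= 'E_(chain_prob X)[@total_reward _ _ _ _ _ pi s X T]
        + (customersR R s + lambda / theta)%:E)%E.
Proof.
move=> T0; case: (chainP X) => X_meas X0 [p p_tf p_X]; exists p => //.
have c_ge0 (y : state K) : 0 <= customersR R y by exact: ler0n.
have bound u x : 0 <= u -> u <= T ->
    (pexp p u x T (@customersR R K) <= (customersR R x + lambda / theta)%:E)%E.
  move=> u0 uT; apply: le_trans (moment K_gt0 lambda_ge0 theta_gt0 mu_ge0 p_tf x u0 uT) _.
  by rewrite lee_fin drain_le// subr_ge0.
have -> : ((completions mu pi p T 0 s)%:E
    = 'E_(chain_prob X)[@total_reward _ _ _ _ _ pi s X T] + pexp p 0 s T (@customersR R K))%E.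
  rewrite (@expected_path_integral _ _ _ s _ _ (chain_prob X) X X_meas X0 p p_X T mu
    (policy_reward mu pi) _ _ _ p_tf); last 3 first.
  - by move=> t y; exact: policy_reward_ge0.
  - by move=> t y; exact: policy_reward_le.
  - by move=> y; exact: policy_reward_meas.
  rewrite (policy_valueK lambda_ge0 theta_gt0 mu_ge0 p_tf T0 (reward_ge0 mu_ge0)
    (reward_le mu_ge0) c_ge0 bound s (lexx 0) T0).
  congr (_ + _)%E; apply: eq_integral => t _; congr pexp; apply/funext => y.
  by apply: eq_bigr => a _; rewrite mulrC.
by rewrite leeDl ?(pexp_ge0 p_tf)//= leeD2l// bound.
Qed.

End RewardBounds.

(** Each neighbourhood of infinity used for [f] is intersected with the set where the comparison
    holds; [e] then tends to 0. *)
Lemma limf_einf_pinfty_le (R : realType) (f g : R -> \bar R) :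
  (forall e : R, 0 < e -> \forall T \near +oo, (f T <= g T + e%:E)%E) ->
  (limf_einf f +oo%R <= limf_einf g +oo%R)%E.
Proof.
move=> fg; apply/lee_addgt0Pr => e e0; rewrite !limf_einfE.
apply: ge_ereal_sup => _ [V V_oo <-]; rewrite -leeBlDr//.
pose W := V `&` [set T | (f T <= g T + e%:E)%E].
have W_oo : (+oo)%R W by apply: filterI => //; exact: fg.
apply: le_trans (ereal_sup_ubound _); last by exists W.
apply: le_ereal_inf_tmp => _ [T [VT fgT] <-]; rewrite leeBlDr//.
by apply: le_trans fgT; apply: ereal_inf_lbound; exists T.
Qed.

Section ThroughputComparison.
Context (R : realType) (K : nat) (lambda theta mu : R).
Hypotheses (K_gt0 : (0 < K)%N).
Hypotheses (lambda_ge0 : 0 <= lambda) (theta_gt0 : 0 < theta) (mu_gt0 : 0 < mu).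

Lemma srept_throughput_ge (pi : policy R K) (s : state K)
    (X : controlled_chain lambda theta mu pi s)
    (Y : controlled_chain lambda theta mu (srept R K) s) :
  (throughput X <= throughput Y)%E.
Proof.
pose c := customersR R s + lambda / theta.
have c0 : 0 <= c by rewrite addr_ge0 ?divr_ge0 ?ler0n// ltW.
apply: limf_einf_pinfty_le => e e0; near=> T.
have T0 : 0 < T by near: T; exact: nbhs_pinfty_gt.
(* For [T >= c / e] the customers left at the horizon cost at most [e] per unit of time. *)
have cT : T^-1 * c <= e.
  rewrite ler_pdivrMl// -ler_pdivrMr//; near: T; exact: nbhs_pinfty_ge.
have [p p_tf /andP[pX _]] :=
  total_reward_completions K_gt0 lambda_ge0 theta_gt0 (ltW mu_gt0) X (ltW T0).
have [ps ps_tf /andP[_ psY]] :=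
  total_reward_completions K_gt0 lambda_ge0 theta_gt0 (ltW mu_gt0) Y (ltW T0).
have T00 : 0 <= (0 : R) <= T by rewrite lexx ltW.
have := srept_completions_ge K_gt0 lambda_ge0 theta_gt0 mu_gt0 p_tf ps_tf (ltW T0) s T00.
rewrite -lee_fin => /(le_trans pX)/le_trans/(_ psY) XY.
have Ti : (0 <= (T^-1)%:E :> \bar R)%E by rewrite lee_fin invr_ge0 ltW.
apply: le_trans (lee_wpmul2l Ti XY) _.
by rewrite muleDr// ?fin_num_adde_defl// leeD2l// lee_fin.
Unshelve. all: by end_near.
Qed.

End ThroughputComparison.

Theorem theorem2p3 (R : realType) (K : nat) (lambda theta mu : R)
    (hK : (1 <= K)%N)
    (hlambda : 0 < lambda) (htheta : 0 < theta) (hmu : 0 < mu)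
    (X : forall (pi : policy R K) (s : state K),
           controlled_chain lambda theta mu pi s) :
  forall s : state K,
    throughput (X (srept R K) s)
    = ereal_sup [set throughput (X pi s) | pi in [set: policy R K]].
Proof.
move=> s; apply/eqP; rewrite eq_le; apply/andP; split.
  by apply: ereal_sup_ubound; exists (srept R K).
apply: ge_ereal_sup => _ [pi _ <-].
by apply: (srept_throughput_ge hK (ltW hlambda)).
Qed.
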